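(* Let $K$ be a field, $S=K[x_1,\ldots,x_n]$, and let $(0)\neq I\subset S$ be a proper squarefree monomial ideal with $\operatorname{hdepth}(S/I)\leq 3$. Then $\operatorname{hdepth}(I)\geq \operatorname{hdepth}(S/I)+1$.
   Context: $S=K[x_1,\ldots,x_n]$ is the polynomial ring over a field $K$ with its standard grading. For a nonzero finitely generated graded $S$-module $M$, the Hilbert depth $\operatorname{hdepth}(M)$ is the maximal depth of a finitely generated graded $S$-module $N$ having the same Hilbert series as $M$. *)

(* Defs.v *)
From HB Require Import structures.
From mathcomp Require Import all_boot all_order all_algebra.
From mathcomp Require Import mpoly.
From Stdlib Require Import ClassicalEpsilon.

Set Implicit Arguments.
Unset Strict Implicit.
Unset Printing Implicit Defensive.

Import GRing.Theory.
Local Open Scope ring_scope.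
Local Open Scope quotient_scope.

(* The maximum of a nonempty bounded set of natural numbers; unspecified when
   no maximum exists. *)
Definition max_nat (P : nat -> Prop) : nat :=
  epsilon (inhabits 0%N) (fun m => P m /\ forall k, P k -> (k <= m)%N).

(* An ideal of R and the quotient of R by it, as R-modules. *)
Section IdealModules.
Variables (R : comNzRingType) (I : idealr R).

Definition ideal_module : Type := {x : R | x \in I}.

HB.instance Definition _ := SubChoice.on ideal_module.
HB.instance Definition _ := [SubChoice_isSubZmodule of ideal_module by <:].

Definition ideal_scale (a : R) (u : ideal_module) : ideal_module :=
  Sub (a * val u) (idealMr a (valP u)).

Fact ideal_scaleA a b u :
  ideal_scale a (ideal_scale b u) = ideal_scale (a * b) u.
Proof. by apply: val_inj; rewrite /= mulrA. Qed.

Fact ideal_scale1 : left_id 1 ideal_scale.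
Proof. by move=> u; apply: val_inj; rewrite /= mul1r. Qed.

Fact ideal_scaleDr : right_distributive ideal_scale +%R.
Proof. by move=> a u v; apply: val_inj; rewrite /= mulrDr. Qed.

Fact ideal_scaleDl u : {morph ideal_scale^~ u : a b / a + b}.
Proof. by move=> a b; apply: val_inj; rewrite /= mulrDl. Qed.

HB.instance Definition _ := GRing.Zmodule_isLmodule.Build R ideal_module
  ideal_scaleA ideal_scale1 ideal_scaleDr ideal_scaleDl.

Definition quotient_module : Type := {ideal_quot I}.

HB.instance Definition _ := GRing.Zmodule.on quotient_module.

Definition quotient_proj (x : R) : quotient_module := \pi_{ideal_quot I} x.

Definition quotient_scale (a : R) (u : quotient_module) : quotient_module :=
  (\pi_{ideal_quot I} a : {ideal_quot I}) * (u : {ideal_quot I}).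

Fact quotient_scaleA a b u :
  quotient_scale a (quotient_scale b u) = quotient_scale (a * b) u.
Proof. by rewrite /quotient_scale rmorphM mulrA. Qed.

Fact quotient_scale1 : left_id 1 quotient_scale.
Proof. by move=> u; rewrite /quotient_scale rmorph1 mul1r. Qed.

Fact quotient_scaleDr : right_distributive quotient_scale +%R.
Proof. by move=> a u v; exact: mulrDr. Qed.

Fact quotient_scaleDl u : {morph quotient_scale^~ u : a b / a + b}.
Proof. by move=> a b; rewrite /quotient_scale rmorphD mulrDl. Qed.

HB.instance Definition _ := GRing.Zmodule_isLmodule.Build R quotient_module
  quotient_scaleA quotient_scale1 quotient_scaleDr quotient_scaleDl.

End IdealModules.

Section RegularSequences.
Variables (R : comNzRingType) (M : lmodType R).

Definition finitely_generated : Prop :=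
  exists gs : seq M, forall v, exists c : 'I_(size gs) -> R,
    v = \sum_(i < size gs) c i *: gs`_i.

(* v lies in the submodule (xs)M *)
Definition in_ideal_mul (xs : seq R) (v : M) : Prop :=
  exists w : 'I_(size xs) -> M, v = \sum_(i < size xs) xs`_i *: w i.

Definition regular_sequence (xs : seq R) : Prop :=
  (forall i, (i < size xs)%N -> forall v : M,
     in_ideal_mul (take i xs) (xs`_i *: v) -> in_ideal_mul (take i xs) v)
  /\ (exists v : M, ~ in_ideal_mul xs v).

End RegularSequences.

Section HilbertDepth.
Variables (K : fieldType) (n : nat).
Local Notation S := {mpoly K[n]}.

(* grade of M with respect to the maximal ideal (x_1, ..., x_n), i.e. the
   ideal of polynomials without constant term *)
Definition depth (M : lmodType S) : nat :=
  max_nat (fun d => exists xs : seq S,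
    [/\ size xs = d, (forall x, x \in xs -> x@_0%MM = 0)
      & regular_sequence M xs]).

(* M is the direct sum of the subgroups M_d (d an integer), with
   S_e M_d contained in M_(d + e). *)
Record is_grading (M : lmodType S) (gr : int -> M -> Prop) : Prop := IsGrading {
  grading0 : forall d, gr d 0;
  gradingB : forall d u v, gr d u -> gr d v -> gr d (u - v);
  gradingZ : forall d (e : nat) (p : S) v,
    p \is e.-homog -> gr d v -> gr (d + e%:Z) (p *: v);
  grading_sum : forall v, exists (ds : seq int) (f : int -> M),
    (forall d, gr d (f d)) /\ v = \sum_(d <- ds) f d;
  grading_direct : forall (ds : seq int) (f : int -> M),
    uniq ds -> (forall d, gr d (f d)) -> \sum_(d <- ds) f d = 0 ->
    forall d, d \in ds -> f d = 0
}.

(* V is a K-subspace of M with a basis of k elements. *)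
Definition has_dim (M : lmodType S) (V : M -> Prop) (k : nat) : Prop :=
  exists e : 'I_k -> M,
    (forall v, V v <->
       exists c : {ffun 'I_k -> K}, v = \sum_(i < k) (c i)%:MP *: e i)
    /\ (forall c : {ffun 'I_k -> K},
          \sum_(i < k) (c i)%:MP *: e i = 0 -> forall i, c i = 0).

Definition same_hilbert_series (M : lmodType S) (grM : int -> M -> Prop)
    (N : lmodType S) (grN : int -> N -> Prop) : Prop :=
  forall d : int, exists k : nat, has_dim (grM d) k /\ has_dim (grN d) k.

Definition hdepth (M : lmodType S) (grM : int -> M -> Prop) : nat :=
  max_nat (fun d => exists (N : lmodType S) (grN : int -> N -> Prop),
    [/\ is_grading grN, finitely_generated N,
        same_hilbert_series grM grN & depth N = d]).

Definition poly_grading (d : int) (p : S) : Prop :=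
  match d with
  | Posz e => p \is e.-homog
  | Negz _ => p = 0
  end.

Definition ideal_grading (I : idealr S) (d : int) (u : ideal_module I) : Prop :=
  poly_grading d (val u).

Definition quotient_grading (I : idealr S) (d : int) (u : quotient_module I) :
    Prop :=
  exists2 p, poly_grading d p & u = quotient_proj I p.

Definition squarefree_monomial_ideal (I : idealr S) : Prop :=
  exists G : seq 'X_{1..n},
    (forall m, m \in G -> forall i, (m i <= 1)%N)
    /\ (forall p, p \in I <->
          exists c : 'X_{1..n} -> S, p = \sum_(m <- G) c m * 'X_[m]).

End HilbertDepth.

(* Main.v *)
Require Import Defs.
From HB Require Import structures.
From mathcomp Require Import all_boot all_order all_algebra.
From mathcomp Require Import mpoly fraction generic_quotient zify.
From Stdlib Require Import Classical ClassicalEpsilon.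

Set Implicit Arguments.
Unset Strict Implicit.
Unset Printing Implicit Defensive.

Import GRing.Theory.
Local Open Scope ring_scope.

(** Let F be the simplicial complex formed by the supports of the squarefree
    monomials outside I, let f_j be its number of faces of size j, and write
    Delta for the backward difference of functions of the degree.  Sorting
    monomials by their support shows that the Hilbert function of S/I is a sum
    over the faces of F, and that of I the same sum over the nonfaces.  The
    theorem follows by comparing Hilbert depth with the positivity of iterated
    differences.

    In one direction ([depth_diff_ge0]), a regular sequence of length q in
    (x_1, ..., x_n) on a graded module N forces Delta^q of the Hilbert function
    of N to be nonnegative.  The sequence may be inhomogeneous and K may be
    finite, so N itself need not have a regular sequence of linear forms.  The
    sequence is therefore traded for the exactness of the Koszul complex of the
    variables on N in degrees below q ([regular_koszul_exact]), a condition that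
    survives the extension of scalars from K to K(z)
    ([fraction_family_exact]).  Over K(z), the linear form sum_i z^i x_i is a
    nonzerodivisor as soon as no nonzero element is killed by all variables
    ([mccoy]); dividing by it applies Delta to the Hilbert function and lowers
    q by one ([quotient_family_exact]).  The same inequality just above the
    lowest degree bounds the length of regular sequences, so that the maxima
    that define depth and Hilbert depth are attained ([depthP], [hdepthP]).

    In the other direction ([realizable_hfaces]), if Delta^d of the Hilbert
    function is nonnegative in degrees at most d, then that function is
    realized by a direct sum of shifted polynomial rings in at least d of the
    variables, on which x_1, ..., x_d is a regular sequence.

    What remains is combinatorial ([diff_nonfaces]): with q = hdepth (S/I) <= 3,
    positivity of Delta^q on the faces must give positivity of Delta^(q+1) on
    the nonfaces.  Unfolded, this asks for upper bounds on alternating sums of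
    f_2, f_3, f_4 in terms of the number f_1 of vertices ([face_ineq2],
    [face_ineq3], [face_ineq4]).  When f_1 is large they follow from the double
    count (k+1) f_(k+1) <= (f_1 - k) f_k.  The finitely many remaining values of
    f_1 need a bound of Kruskal-Katona type, obtained by repeatedly deleting a
    vertex of least degree ([fnum_shadow_bound]) and evaluated on all possible
    face numbers. *)

(** * Koszul complexes *)

(** Cochains of the Koszul complex on n operators with coefficients in V: the
    exterior algebra on e_0, ..., e_(n-1) is built one generator at a time, and
    the pair (a, b) at stage m.+1 stands for a + e_m b.  All exterior degrees
    are kept together. *)
Fixpoint koszul (V : zmodType) (n : nat) : zmodType :=
  if n is m.+1 then (koszul V m * koszul V m)%type else V.

Fixpoint kmap (V W : zmodType) (f : V -> W) n : koszul V n -> koszul W n :=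
  if n is m.+1 then fun c => (kmap f c.1, kmap f c.2) else f.

(** Left multiplication by sum_i x_i e_i.  The operators x_i may change the
    coefficient space, which allows differentials between graded pieces. *)
Fixpoint koszul_d (V W : zmodType) (x : nat -> V -> W) n : koszul V n ->
  koszul W n :=
  if n is m.+1 then fun c => (koszul_d x c.1, kmap (x m) c.1 - koszul_d x c.2)
  else fun _ => 0.

Fixpoint kall (V : zmodType) (P : V -> Prop) n : koszul V n -> Prop :=
  if n is m.+1 then fun c => kall P c.1 /\ kall P c.2 else P.

(** The components of exterior degree less than q. *)
Fixpoint ktrunc (V : zmodType) n (q : nat) : koszul V n -> koszul V n :=
  if n is m.+1 then fun c => (ktrunc q c.1, ktrunc q.-1 c.2)
  else fun c => if q is 0 then 0 else c.
Arguments ktrunc {V n} q c.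

Section KoszulAdditive.
Variables (V W : zmodType).

Fact kmap_additive (f : {additive V -> W}) n : zmod_morphism (@kmap V W f n).
Proof.
elim: n => [|n IH] /=; first exact: raddfB.
by move=> [a b] [c d] /=; rewrite !IH.
Qed.
HB.instance Definition _ (f : {additive V -> W}) n :=
  GRing.isZmodMorphism.Build (koszul V n) (koszul W n) (@kmap V W f n)
    (@kmap_additive f n).

Fact koszul_d_additive (x : nat -> {additive V -> W}) n :
  zmod_morphism (@koszul_d V W x n).
Proof.
elim: n => [|n IH] /=; first by move=> *; rewrite subr0.
move=> [a b] [c d] /=; rewrite !IH raddfB /=; congr pair => /=.
by rewrite -!addrA; congr (_ + _); rewrite !opprD !opprK addrCA !addrA.
Qed.
HB.instance Definition _ (x : nat -> {additive V -> W}) n :=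
  GRing.isZmodMorphism.Build (koszul V n) (koszul W n) (@koszul_d V W x n)
    (@koszul_d_additive x n).

Fact ktrunc_additive n q : zmod_morphism (@ktrunc V n q).
Proof.
elim: n q => [|n IH] q /=; first by move=> a b; case: q; rewrite ?subr0.
by move=> [a b] [c d] /=; rewrite !IH.
Qed.
HB.instance Definition _ n q :=
  GRing.isZmodMorphism.Build (koszul V n) (koszul V n) (@ktrunc V n q)
    (@ktrunc_additive n q).

End KoszulAdditive.

Lemma kmap_comp (U V W : zmodType) (f : U -> V) (g : V -> W) n (c : koszul U n) :
  kmap g (kmap f c) = kmap (g \o f) c.
Proof. by elim: n c => //= n IH [a b]; rewrite !IH. Qed.

Lemma eq_kmap (V W : zmodType) (f g : V -> W) n (c : koszul V n) :
  f =1 g -> kmap f c = kmap g c.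
Proof. by move=> fg; elim: n c => //= n IH [a b]; rewrite !IH. Qed.

Lemma kmap_id (V : zmodType) (f : V -> V) n (c : koszul V n) :
  f =1 id -> kmap f c = c.
Proof. by move=> fg; elim: n c => //= n IH [a b]; rewrite !IH. Qed.

Lemma kmapD_fun (V W : zmodType) (f g : V -> W) n (c : koszul V n) :
  kmap (fun v => f v + g v) c = kmap f c + kmap g c.
Proof. by elim: n c => //= n IH [a b]; rewrite !IH. Qed.

Lemma kmap_inj (V W : zmodType) (f : V -> W) n :
  injective f -> injective (@kmap V W f n).
Proof.
by move=> f_inj; elim: n => //= n IH [a b] [c d] /= [] /IH-> /IH->.
Qed.

Lemma koszul_d_map (V W V' W' : zmodType) (x : nat -> V -> W) (y : nat ->
  V' -> W')
    (f : V -> V') (g : {additive W -> W'}) n (c : koszul V n) :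
  (forall i v, y i (f v) = g (x i v)) -> koszul_d y (kmap f c)
    = kmap g (koszul_d x c).
Proof.
move=> H; elim: n c => [|n IH] /= => [_|[a b] /=]; first by rewrite raddf0.
rewrite !IH raddfB /=; congr (_, _ - _).
by rewrite kmap_comp [RHS]kmap_comp; apply: eq_kmap => v /=.
Qed.

(** The square of an odd element of the exterior algebra vanishes, provided
    that the operators commute. *)
Lemma koszul_dd (U V W : zmodType) (x : nat -> {additive U -> V})
    (y : nat -> {additive V -> W}) n (c : koszul U n) :
  (forall i j v, y i (x j v) = y j (x i v)) -> koszul_d y (koszul_d x c) = 0.
Proof.
move=> H; elim: n c => [|n IH] //= [a b] /=; rewrite raddfB /= !IH subr0.
by rewrite (@koszul_d_map _ _ _ _ x y (x n) (y n)) ?subrr // => i v; exact: H.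
Qed.

Lemma ktrunc0 (V : zmodType) n (c : koszul V n) : ktrunc 0 c = 0.
Proof. by elim: n c => //= n IH [a b] /=; rewrite !IH. Qed.

Lemma ktrunc_kmap (V W : zmodType) (f : {additive V -> W}) n q (c : koszul V n) :
  ktrunc q (kmap f c) = kmap f (ktrunc q c).
Proof.
elim: n q c => [|n IH] q c /=; first by case: q => //; rewrite raddf0.
by rewrite !IH.
Qed.

(** The differential raises the exterior degree by one. *)
Lemma ktrunc_koszul_d (V W : zmodType) (x : nat -> {additive V -> W}) n q
    (c : koszul V n) :
  ktrunc q.+1 (koszul_d x c) = koszul_d x (ktrunc q c).
Proof.
elim: n q c => [|n IH] q //= [a b] /=; rewrite IH raddfB /= ktrunc_kmap.
congr (_, _ - _); case: q => [|q]; last exact: IH.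
by rewrite !ktrunc0 raddf0.
Qed.

Lemma ktruncS (V : zmodType) n q (c : koszul V n) :
  ktrunc q c = c -> ktrunc q.+1 c = c.
Proof.
elim: n q c => [|n IH] q /=; first by case: q.
move=> [a b] /= [Ha Hb]; congr pair; first exact: IH.
case: q Ha Hb => [|q] _ Hb; last exact: IH.
by rewrite /= ktrunc0 in Hb *.
Qed.


Lemma ktrunc_id (V : zmodType) n q (c : koszul V n) :
  ktrunc q (ktrunc q c) = ktrunc q c.
Proof. by elim: n q c => [|n IH] q c /=; [case: q | rewrite !IH]. Qed.

(** * Regular sequences and Koszul exactness *)

Section Kall.
Variables (V : zmodType) (P : V -> Prop).
Hypotheses (P0 : P 0) (PB : forall u v, P u -> P v -> P (u - v)).

Lemma kall0 n : kall P (0 : koszul V n).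
Proof. by elim: n. Qed.

Lemma kallB n (c d : koszul V n) : kall P c -> kall P d -> kall P (c - d).
Proof.
elim: n c d => [|n IH] c d /=; first exact: PB.
by case=> c1 c2 [d1 d2]; split; exact: IH.
Qed.

Lemma kallN n (c : koszul V n) : kall P c -> kall P (- c).
Proof. by rewrite -sub0r; apply: kallB; exact: kall0. Qed.

Lemma kallD n (c d : koszul V n) : kall P c -> kall P d -> kall P (c + d).
Proof. by rewrite -[d]opprK => Pc /kallN Pd; apply: kallB;
  rewrite ?opprK // in Pd *. Qed.

End Kall.

Lemma kall_impl (V : zmodType) (P Q : V -> Prop) n (c : koszul V n) :
  (forall v, P v -> Q v) -> kall P c -> kall Q c.
Proof. by move=> PQ; elim: n c => [|n IH] c /=;
  [exact: PQ | case=> /IH ? /IH]. Qed.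

Lemma kall_kmap (V W : zmodType) (P : V -> Prop) (Q : W -> Prop)
    (f : V -> W) n (c : koszul V n) :
  (forall v, P v -> Q (f v)) -> kall P c -> kall Q (kmap f c).
Proof. by move=> PQ; elim: n c => [|n IH] c /=;
  [exact: PQ | case=> /IH ? /IH]. Qed.

Lemma kall_kmapE (V W : zmodType) (P : V -> Prop) (Q : W -> Prop)
    (f : V -> W) n (c : koszul V n) :
  (forall v, Q (f v) -> P v) -> kall Q (kmap f c) -> kall P c.
Proof. by move=> PQ; elim: n c => [|n IH] c /=;
  [exact: PQ | case=> /IH ? /IH]. Qed.

(** Chooses, component by component, preimages under f modulo Q. *)
Lemma kall_mod_image (V W : zmodType) (P Q : V -> Prop) (f : W -> V) n (c :
  koszul V n) :
  (forall v, P v -> exists w, Q (v - f w)) ->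
  kall P c -> exists e : koszul W n, kall Q (c - kmap f e).
Proof.
move=> H; elim: n c => [|n IH] c /=; first exact: H.
by case=> /IH[e1 H1] /IH[e2 H2]; exists (e1, e2).
Qed.

Lemma kall_eq0 (V : zmodType) m (c : koszul V m) : kall (fun v => v = 0) c ->
  c = 0.
Proof. by elim: m c => [|m IH] //= [a b] /= [/IH-> /IH->]. Qed.

Lemma kmap_lift (V W U : zmodType) (f : V -> U) (g : W -> U) m (c : koszul V m) :
  (forall v, exists w, f v = g w) -> exists b, kmap f c = kmap g b.
Proof.
move=> fg; elim: m c => [|m IH] c /=; first exact: fg.
by have [b1 ->] := IH c.1; have [b2 ->] := IH c.2; exists (b1, b2).
Qed.

Section InIdealMul.
Variables (R : comNzRingType) (M : lmodType R).
Implicit Types (xs : seq R) (u v : M).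

Lemma in_ideal_mulP xs v :
  in_ideal_mul xs v <->
  exists w : nat -> M, v = \sum_(i < size xs) xs`_i *: w i.
Proof.
split=> [[w ->]|[w ->]]; last by exists (fun i => w i).
exists (fun i => if insub i is Some j then w j else 0).
by apply: eq_bigr => i _; rewrite valK.
Qed.

Lemma in_ideal_mul0 xs : in_ideal_mul xs (0 : M).
Proof. by exists (fun=> 0); rewrite big1 // => i _; rewrite scaler0. Qed.

Lemma in_ideal_mulB xs u v :
  in_ideal_mul xs u -> in_ideal_mul xs v -> in_ideal_mul xs (u - v).
Proof.
move=> [a ->] [b ->]; exists (fun i => a i - b i).
by rewrite -sumrB; apply: eq_bigr => i _; rewrite scalerBr.
Qed.

Lemma in_ideal_mulD xs u v :
  in_ideal_mul xs u -> in_ideal_mul xs v -> in_ideal_mul xs (u + v).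
Proof.
move=> [a ->] [b ->]; exists (fun i => a i + b i).
by rewrite -big_split; apply: eq_bigr => i _; rewrite scalerDr.
Qed.

Lemma in_ideal_mulZ xs (r : R) v : in_ideal_mul xs v -> in_ideal_mul xs (r *: v).
Proof.
move=> [a ->]; exists (fun i => r *: a i).
by rewrite scaler_sumr; apply: eq_bigr => i _; rewrite !scalerA mulrC.
Qed.

Lemma in_ideal_mul_mem xs x v : x \in xs -> in_ideal_mul xs (x *: v).
Proof.
move=> /(nthP 0)[i ilt <-]; exists (fun j : 'I__ =>
  if i == j :> nat then v else 0).
rewrite (bigD1 (Ordinal ilt)) //= eqxx big1 ?addr0 // => j.
by rewrite -val_eqE /= eq_sym => /negPf->; rewrite scaler0.
Qed.

Lemma in_ideal_mul_rcons xs y v :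
  in_ideal_mul (rcons xs y) v <-> exists w, in_ideal_mul xs (v - y *: w).
Proof.
split=> [/in_ideal_mulP[w ->]|[w /in_ideal_mulP[a va]]].
  exists (w (size xs)); apply/in_ideal_mulP; exists w.
  rewrite size_rcons big_ord_recr /= nth_rcons ltnn eqxx addrK.
  by apply: eq_bigr => i _; rewrite nth_rcons ltn_ord.
apply/in_ideal_mulP; exists (fun i => if i == size xs then w else a i).
rewrite size_rcons big_ord_recr /= nth_rcons ltnn eqxx.
apply/(canRL (subrK _)); rewrite va; apply: eq_bigr => i _.
by rewrite nth_rcons ltn_ord ltn_eqF.
Qed.

End InIdealMul.

Section KoszulModule.
Variables (R : comNzRingType) (M : lmodType R).

(** Contraction of cochains against the covector with coordinates a_i. *)
Fixpoint kcontract (a : nat -> R) n : koszul M n -> koszul M n :=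
  if n is m.+1 then fun c =>
    (kcontract a c.1 + kmap ( *:%R (a m)) c.2, - kcontract a c.2)
  else fun=> 0.

Lemma ktrunc_contract (a : nat -> R) n q (c : koszul M n) :
  ktrunc q (kcontract a c) = kcontract a (ktrunc q.+1 c).
Proof.
have s0 m : kcontract a (0 : koszul M m) = 0.
  by elim: m => //= m ->; rewrite raddf0 addr0 oppr0.
elim: n q c => [|n IH] q c /=; first by case: q.
rewrite raddfD raddfN /= IH ktrunc_kmap; congr (_, - _).
by case: q => [|q]; [rewrite !ktrunc0 s0 | rewrite IH].
Qed.

Lemma kcontractB (a : nat -> R) n (c d : koszul M n) :
  kcontract a (c - d) = kcontract a c - kcontract a d.
Proof.
elim: n c d => [|n IH] c d /=; first by rewrite subr0.
rewrite !IH raddfB /=; congr pair => /=; last by rewrite opprD.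
by rewrite opprD addrACA.
Qed.

Lemma kcontract_kmap (a : nat -> R) (r : R) n (c : koszul M n) :
  kcontract a (kmap ( *:%R r) c) = kmap ( *:%R r) (kcontract a c).
Proof.
elim: n c => [|n IH] c /=; first by rewrite scaler0.
rewrite !IH raddfD raddfN /=; congr (_ + _, _).
by rewrite kmap_comp [RHS]kmap_comp; apply: eq_kmap => v /=;
   rewrite !scalerA mulrC.
Qed.

(** Multiplication by an element of the ideal generated by the operators is
    null-homotopic, the homotopy being the contraction by its coefficients. *)
Lemma koszul_homotopy (a x : nat -> R) n (c : koszul M n) :
  koszul_d (fun i => *:%R (x i)) (kcontract a c)
    + kcontract a (koszul_d (fun i => *:%R (x i)) c)
  = kmap ( *:%R (\sum_(i < n) a i * x i)) c.
Proof.
have kdC (r : R) m (b : koszul M m) : koszul_d (fun i =>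
  *:%R (x i)) (kmap ( *:%R r) b)
    = kmap ( *:%R r) (koszul_d (fun i => *:%R (x i)) b).
  by apply: koszul_d_map => i v /=; rewrite !scalerA mulrC.
elim: n c => [|n IH] c /=; first by rewrite big_ord0 addr0 scale0r.
rewrite big_ord_recr /=.
have E m (b : koszul M m) : kmap ( *:%R (\sum_(i < n) a i * x i + a n * x n)) b =
    kmap ( *:%R (\sum_(i < n) a i * x i)) b + kmap ( *:%R (a n)) (kmap ( *:%R
      (x n)) b).
  rewrite kmap_comp -kmapD_fun; apply: eq_kmap => v /=.
  by rewrite scalerDl scalerA.
have E' m (b : koszul M m) : kmap ( *:%R (x n)) (kmap ( *:%R (a n)) b) =
    kmap ( *:%R (a n)) (kmap ( *:%R (x n)) b).
  by rewrite kmap_comp [RHS]kmap_comp; apply: eq_kmap => v;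
    rewrite /= !scalerA mulrC.
rewrite !E -!IH !raddfD !raddfN /= kcontractB kcontract_kmap kdC E'.
congr pair; rewrite /=.
  by rewrite addrACA [X in _ + X = _]addrCA subrr addr0.
rewrite opprK opprB [LHS]addrC -[_ + _ + koszul_d _ _]addrA subrKA.
by rewrite addrA [LHS]addrC addrA [LHS]addrAC addrAC.
Qed.


(** Depth sensitivity of the Koszul complex, for coefficients in M modulo the
    first i terms of the sequence.  Let y be the next term.  If c is a cocycle
    below degree m.+1, the homotopy s for y gives y c = d (s c) modulo that
    submodule U, so s c is a cocycle modulo (U, y), in one degree less.  By
    induction s c = d b + y g modulo U, hence y (c - d g) lies in U, and y can be
    cancelled.  Working modulo submodules avoids forming quotient modules. *)
Lemma regular_koszul_exact (x : nat -> R) n (ys : seq R) :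
  (forall i, (i < size ys)%N -> forall v : M,
     in_ideal_mul (take i ys) (ys`_i *: v) -> in_ideal_mul (take i ys) v) ->
  (forall y, y \in ys -> exists a : nat -> R, y = \sum_(i < n) a i * x i) ->
  forall m i, (i + m)%N = size ys -> forall c : koszul M n,
  ktrunc m c = c ->
  kall (in_ideal_mul (take i ys)) (koszul_d (fun j => *:%R (x j)) c) ->
  exists b, kall (in_ideal_mul (take i ys)) (c - koszul_d (fun j =>
    *:%R (x j)) b).
Proof.
move=> reg ysx.
set U := fun i => in_ideal_mul (take i ys) : M -> Prop.
have U0 i : U i 0 by exact: in_ideal_mul0.
have UB i u v : U i u -> U i v -> U i (u - v) by exact: in_ideal_mulB.
have UZ i r v : U i v -> U i (r *: v) by exact: in_ideal_mulZ.
elim=> [|m IH] i im c cm dc.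
  exists 0; rewrite -cm ktrunc0 raddf0 subr0; exact: (kall0 (U0 i)).
have ilt : (i < size ys)%N by rewrite -im addnS leq_addr.
have [a ya] : exists a : nat -> R, ys`_i = \sum_(i < n) a i * x i.
  by apply: ysx; exact: mem_nth.
pose d k := @koszul_d M M (fun j => *:%R (x j)) k.
set y := ys`_i in ya *.
have yc : kmap ( *:%R y) c = d n (kcontract a c) + kcontract a (d n c).
  by rewrite ya koszul_homotopy.
have sU k (e : koszul M k) : kall (U i) e -> kall (U i) (kcontract a e).
  elim: k e => [|k IHk] e //= [e1 e2]; split.
    apply: (kallD (U0 i) (@UB i)); first exact: IHk.
    by apply: kall_kmap e2 => v; apply: UZ.
  by apply: (kallN (U0 i) (@UB i)); exact: IHk.
have UyS v : U i.+1 v <-> exists w, U i (v - y *: w).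
  by rewrite /U (take_nth 0) //; apply: in_ideal_mul_rcons.
have UiS v : U i v -> U i.+1 v.
  by move=> Uv; apply/UyS; exists 0; rewrite scaler0 subr0.
have [|||b Hb] := IH i.+1 _ (kcontract a c).
- by rewrite addSnnS.
- by rewrite ktrunc_contract cm.
- have -> : koszul_d (fun j => *:%R (x j)) (kcontract a c)
      = kmap ( *:%R y) c - kcontract a (d n c) by rewrite yc addrK.
  apply: (kallB (@UB i.+1)).
    elim: (n) (c) => [|k IHk] e /=; last by split; exact: IHk.
    by apply/UyS; exists e; rewrite subrr; exact: U0.
  by apply: kall_impl (sU _ _ dc); exact: UiS.
have [g Hg] : exists g : koszul M n, kall (U i) (kcontract a c - d n b - kmap (
  *:%R y) g).
  by apply: kall_mod_image Hb => v /UyS.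
exists g.
have dU k (e : koszul M k) : kall (U i) e -> kall (U i) (d k e).
  elim: k e => [|k IHk] e /=; first by move=> _; exact: U0.
  case=> e1 e2; split; first exact: IHk.
  apply: (kallB (@UB i)); last exact: IHk.
  by apply: kall_kmap e1 => v; exact: UZ.
apply: (@kall_kmapE _ _ _ (U i) ( *:%R y)); first exact: reg.
have {}Hg := dU _ _ Hg.
have ddb : d n (d n b) = 0.
  by apply: koszul_dd => k l v /=; rewrite !scalerA mulrC.
have dyg : d n (kmap ( *:%R y) g) = kmap ( *:%R y) (d n g).
  by apply: koszul_d_map => k v /=; rewrite !scalerA mulrC.
have -> : kmap ( *:%R y) (c - koszul_d (fun j => *:%R (x j)) g) =
    d n (kcontract a c - d n b - kmap ( *:%R y) g) + kcontract a (d n c).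
  by rewrite /d !raddfB /= -/(d n) ddb subr0 dyg yc addrAC.
by apply: (kallD (U0 i) (@UB i)) => //; exact: sU.
Qed.

End KoszulModule.

(** * Graded families of finite-dimensional spaces *)

(** A graded module over a polynomial ring, bounded below and with
    finite-dimensional pieces, given by the matrices of the variables acting on
    row vectors.  Index 0 holds the zero space below the lowest degree, so that
    degree d sits at index d.+1; Koszul exactness in the lowest degree then needs
    no separate case. *)
Record graded_family (F : fieldType) := GradedFamily {
  gdim : nat -> nat;
  gact : nat -> forall d, 'M[F]_(gdim d, gdim d.+1);
  gactC : forall i j d, gact i d *m gact j d.+1 = gact j d *m gact i d.+1;
  gdim0 : gdim 0 = 0%N
}.

Definition gop (F : fieldType) (A : graded_family F) d (i : nat) :
    {additive 'rV[F]_(gdim A d) -> 'rV[F]_(gdim A d.+1)} :=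
  mulmxr (gact A i d).

(** Vanishing of the cohomology of the Koszul complex of the first n operators
    in all exterior degrees less than q. *)
Definition koszul_exact (F : fieldType) (A : graded_family F) (n q : nat) :
  Prop :=
  forall d (c : koszul 'rV[F]_(gdim A d.+1) n),
    ktrunc q c = c -> koszul_d (gop A d.+1) c = 0 ->
    exists b : koszul 'rV[F]_(gdim A d) n, c = koszul_d (gop A d) b.

Lemma gopC (F : fieldType) (A : graded_family F) d i j v :
  gop A d.+1 i (gop A d j v) = gop A d.+1 j (gop A d i v).
Proof. by rewrite /= -!mulmxA gactC. Qed.

Section Quotient.
Variables (F : fieldType) (A : graded_family F) (n q : nat).
Variable l : forall d, 'M[F]_(gdim A d, gdim A d.+1).
Hypothesis lC : forall i d, l d *m gact A i d.+1 = gact A i d *m l d.+1.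
Hypothesis l_free : forall d, row_free (l d).

(** The quotient by the image of l is realized on the cokernels of the maps
    [l d]: [qproj] is the projection onto the cokernel in a basis, and its
    left inverse [pinvmx] a choice of representatives. *)
Definition qdim d := if d is d'.+1 then \rank (cokermx (l d')) else 0%N.

Definition qproj d : 'M[F]_(gdim A d, qdim d) :=
  match d return 'M[F]_(gdim A d, qdim d) with
  | 0%N => 0
  | d'.+1 => col_base (cokermx (l d'))
  end.

Local Arguments qproj : simpl never.

Definition qact i d := pinvmx (qproj d) *m gact A i d *m qproj d.+1.

Lemma row0_eq m (B C : 'M[F]_(gdim A 0, m)) : B = C.
Proof. by apply/matrixP => i; have := ltn_ord i; rewrite {2}gdim0. Qed.

Lemma qprojK d : pinvmx (qproj d) *m qproj d = 1%:M.
Proof.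
case: d => [|d]; first by apply/matrixP; case.
by rewrite mulVpmx // col_base_full.
Qed.

Lemma mul_l_qproj d : l d *m qproj d.+1 = 0.
Proof.
have := mulmx_coker (l d); rewrite -{1}(mulmx_base (cokermx (l d))) mulmxA.
move=> /(congr1 (mulmx^~ (pinvmx (row_base (cokermx (l d)))))).
by rewrite mul0mx -mulmxA mulmxVp ?row_base_free // mulmx1.
Qed.

Lemma qproj_eq0 m d (v : 'M[F]_(m, gdim A d.+1)) :
  v *m qproj d.+1 = 0 -> exists u, v = u *m l d.
Proof.
move=> v0; apply/submxP; rewrite submxE.
by rewrite -(mulmx_base (cokermx (l d))) mulmxA [v *m _]v0 mul0mx.
Qed.

Lemma qact_proj i d : qproj d *m qact i d = gact A i d *m qproj d.+1.
Proof.
case: d => [|d]; first exact: row0_eq.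
have [|u Hu] := @qproj_eq0 _ d (1%:M - qproj d.+1 *m pinvmx (qproj d.+1)).
  by rewrite mulmxBl mul1mx -mulmxA qprojK mulmx1 subrr.
apply/esym/eqP; rewrite -subr_eq0.
have -> : gact A i d.+1 *m qproj d.+2 - qproj d.+1 *m qact i d.+1
   = (1%:M - qproj d.+1 *m pinvmx (qproj d.+1)) *m gact A i d.+1 *m qproj d.+2.
  by rewrite !mulmxBl mul1mx /qact !mulmxA.
by rewrite Hu -[u *m _ *m _]mulmxA lC -!mulmxA mul_l_qproj !mulmx0.
Qed.

Lemma qactC i j d : qact i d *m qact j d.+1 = qact j d *m qact i d.+1.
Proof.
suff E a b : qact a d *m qact b d.+1 =
    pinvmx (qproj d) *m (gact A a d *m gact A b d.+1) *m qproj d.+2.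
  by rewrite !E gactC.
by rewrite {1}/qact -mulmxA qact_proj !mulmxA.
Qed.

Definition quotient_family : graded_family F :=
  @GradedFamily F qdim qact qactC erefl.

Lemma quotient_family_dim d : (gdim quotient_family d.+1 + gdim A d
  = gdim A d.+1)%N.
Proof.
rewrite /= mxrank_coker; have /eqP := l_free d => ->.
by rewrite subnK // -(eqP (l_free d)) rank_leq_col.
Qed.

(** The long exact sequence of 0 -> A -> A -> A/l -> 0, chased on cochains: a
    cocycle c of the quotient lifts to c', and d c' = l e with e a cocycle of
    degree at most q; then e = d f, and c' - l f is a cocycle that lifts c. *)
Lemma quotient_family_exact : koszul_exact A n q.+1 ->
  koszul_exact quotient_family n q.
Proof.
move=> exA d c cq dc.
pose p e : {additive 'rV[F]_(gdim A e) -> 'rV[F]_(gdim quotient_family e)} :=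
  mulmxr (qproj e).
pose s e : {additive 'rV[F]_(gdim quotient_family e) -> 'rV[F]_(gdim A e)} :=
  mulmxr (pinvmx (qproj e)).
pose m e : {additive 'rV[F]_(gdim A e) -> 'rV[F]_(gdim A e.+1)} := mulmxr (l e).
have kd_p e (b : koszul 'rV[F]_(gdim A e) n) :
    koszul_d (gop quotient_family e) (kmap (p e) b)
      = kmap (p e.+1) (koszul_d (gop A e) b).
  by apply: koszul_d_map => i v; rewrite /= -!mulmxA qact_proj.
have kd_m e (b : koszul 'rV[F]_(gdim A e) n) :
    koszul_d (gop A e.+1) (kmap (m e) b) = kmap (m e.+1) (koszul_d (gop A e) b).
  by apply: koszul_d_map => i v; rewrite /= -!mulmxA lC.
have pm e (b : koszul 'rV[F]_(gdim A e) n) : kmap (p e.+1) (kmap (m e) b) = 0.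
  rewrite kmap_comp; elim: (n) (b) => [|k IH] a /=; last by rewrite !IH.
  by rewrite -mulmxA mul_l_qproj mulmx0.
have m_inj e : injective (@kmap _ _ (m e) n).
  by apply: kmap_inj; exact: row_free_inj.
pose c' := kmap (s d.+1) c.
have pc' : kmap (p d.+1) c' = c.
  rewrite kmap_comp; apply: kmap_id => v /=.
  by have := congr1 (mulmx (v : 'rV_(qdim d.+1))) (qprojK d.+1);
    rewrite mulmxA mulmx1.
have [e He] : exists e, kmap (m d.+1) e = koszul_d (gop A d.+1) c'.
  have : kmap (p d.+2) (koszul_d (gop A d.+1) c') = 0 by rewrite -kd_p pc' dc.
  elim: (n) (koszul_d _ c') => [|k IH] v /=.
    by move=> /qproj_eq0[u ->]; exists u.
  by case=> /IH[e1 E1] /IH[e2 E2]; exists (e1, e2); rewrite /= E1 E2; case: (v).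
have eq1 : ktrunc q.+1 e = e.
  apply: (m_inj d.+1); rewrite -ktrunc_kmap He ktrunc_koszul_d.
  by rewrite ktrunc_kmap cq.
have de : koszul_d (gop A d.+1) e = 0.
  apply: (m_inj d.+2); rewrite -kd_m He raddf0 koszul_dd // => i j v.
  exact: gopC.
have [f Hf] := exA d e eq1 de.
pose f' := ktrunc q f.
have Hf' : e = koszul_d (gop A d) f' by rewrite -ktrunc_koszul_d -Hf eq1.
have [||b Hb] := exA d (c' - kmap (m d) f').
- apply: ktruncS; rewrite raddfB /= !ktrunc_kmap cq.
  by rewrite ktrunc_id.
- by rewrite raddfB /= kd_m -He Hf' subrr.
exists (kmap (p d) b); rewrite kd_p -Hb raddfB /= pm subr0 pc' //.
Qed.

End Quotient.

(** * Passing to the field of rational functions *)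

Section ClearDenominators.
Variable D : idomainType.
Local Notation L := {fraction D}.
Local Notation "x %:F" := (@FracField.tofrac D x).
Import FracField.
Local Open Scope quotient_scope.

Lemma frac_clear (x : L) : exists s a : D, s != 0 /\ s%:F * x = a%:F.
Proof.
exists (\d_(repr x)), (\n_(repr x)); split; first exact: denom_ratioP.
rewrite -{2}[x]reprK !piE; apply/eqmodP => /=.
by rewrite /FracField.equivf /= /mulf !numden_Ratio ?mul1r ?mulr1 ?oner_eq0
  ?denom_ratioP.
Qed.


Lemma koszul_clear m n (c : koszul 'rV[L]_m n) :
  exists (s : D) (c' : koszul 'rV[D]_m n),
    s != 0 /\ kmap ( *:%R s%:F) c = kmap (map_mx (@FracField.tofrac D)) c'.
Proof.
elim: n c => [|n IH] c /=.
  have /fin_all_exists[s /fin_all_exists[a sa]] j := frac_clear (c 0 j).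
  exists (\prod_j s j), (\row_j (a j * \prod_(k | k != j) s k)); split.
    by apply/prodf_neq0 => j _; case: (sa j).
  apply/rowP => j; rewrite !mxE (bigD1 j) //= !rmorphM /= -(sa j).2.
  by rewrite mulrAC.
have [s1 [a1 [s10 E1]]] := IH c.1.
have [s2 [a2 [s20 E2]]] := IH c.2.
exists (s1 * s2), (kmap ( *:%R s2) a1, kmap ( *:%R s1) a2).
split; first by rewrite mulf_neq0.
have E (s t : D) (u : koszul 'rV[L]_m n) (v : koszul 'rV[D]_m n) :
    kmap ( *:%R s%:F) u = kmap (map_mx (@FracField.tofrac D)) v ->
    kmap ( *:%R (t * s)%:F) u = kmap (map_mx (@FracField.tofrac D)) (kmap (
      *:%R t) v).
  move=> H; transitivity (kmap ( *:%R t%:F) (kmap ( *:%R s%:F) u)).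
    by rewrite kmap_comp; apply: eq_kmap => w /=; rewrite rmorphM scalerA.
  rewrite H kmap_comp [RHS]kmap_comp; apply: eq_kmap => w /=.
  by apply/rowP => j; rewrite !mxE rmorphM.
by congr pair; rewrite /= ?(E _ _ _ _ E2) // [s1 * s2]mulrC (E _ _ _ _ E1).
Qed.

End ClearDenominators.

Section McCoy.
Variables (F : fieldType) (A : graded_family F) (n : nat).
Hypothesis soc0 : forall d (v : 'rV[F]_(gdim A d)),
  (forall i, (i < n)%N -> v *m gact A i d = 0) -> v = 0.

(** McCoy's argument.  Let v_k be the coefficients of a polynomial vector v of
    degree less than s that is killed by sum_i z^i X_i.  The top coefficient is
    killed by the last operator, so v X_(n-1) has lower degree; it is still
    killed by the form, hence is zero by induction.  Going down through the
    operators, every X_i kills v, and v = 0. *)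
Lemma mccoy s d (v : nat -> 'rV[F]_(gdim A d)) :
  (forall k, (s <= k)%N -> v k = 0) ->
  (forall m, \sum_(i < n | (i <= m)%N) v (m - i)%N *m gact A i d = 0) ->
  forall k, v k = 0.
Proof.
elim: s d v => [|s IH] d v vs lv k; first exact: vs.
suff H j : forall i, (i < n)%N -> (n <= i + j)%N ->
  forall k, v k *m gact A i d = 0.
  by apply: soc0 => i ilt; apply: (H n); rewrite ?leq_addl.
elim: j => [|j IHj] i ilt nij; first by rewrite addn0 leqNgt ilt in nij.
have IHj' i' k' : (i' < n)%N -> (i < i')%N -> v k' *m gact A i' d = 0.
  by move=> lt1 lt2; apply: IHj => //; lia.
have vsi : v s *m gact A i d = 0.
  have := lv (s + i)%N.
  rewrite (bigD1 (Ordinal ilt)) /= ?leq_addl // addnK big1 ?addr0 // => i'.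
  case/andP=> i's; rewrite -val_eqE /= neq_ltn => /orP[lt|gt].
    by rewrite vs ?mul0mx //; lia.
  exact: IHj'.
apply: (IH d.+1 (fun k => v k *m gact A i d)) => [k' | m].
  rewrite leq_eqVlt => /predU1P[<- //|lt]; by rewrite vs ?mul0mx.
transitivity ((\sum_(i' < n | (i' <= m)%N) v (m - i')%N *m gact A i' d)
    *m gact A i d.+1); last by rewrite lv mul0mx.
rewrite mulmx_suml; apply: eq_bigr => i' _.
by rewrite -!mulmxA gactC.
Qed.

End McCoy.

(** The inclusion of exterior degree 0. *)
Fixpoint kbase (V : zmodType) n (v : V) : koszul V n :=
  if n is m.+1 then (kbase m v, 0) else v.
Arguments kbase {V} n v.

Lemma kmap_base (V W : zmodType) (f : {additive V -> W}) n (v : V) :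
  kmap f (kbase n v) = kbase n (f v).
Proof. by elim: n => //= n ->; rewrite raddf0. Qed.

Lemma koszul_exact_soc (F : fieldType) (A : graded_family F) n q :
  koszul_exact A n q.+1 ->
  forall d (v : 'rV[F]_(gdim A d)),
  (forall i, (i < n)%N -> v *m gact A i d = 0) -> v = 0.
Proof.
move=> exA [|d] v vX; first by apply/rowP => i; have := ltn_ord i;
  rewrite {2}gdim0.
have kt m p : ktrunc p.+1 (kbase m v) = kbase m v.
  by elim: m => //= m ->; rewrite raddf0.
have kd0 m : (m <= n)%N -> koszul_d (gop A d.+1) (kbase m v) = 0.
  elim: m => //= m IH lt; rewrite IH 1?ltnW // raddf0 subr0.
  rewrite kmap_base /= vX //; congr pair.
  by elim: (m) => //= k ->.
have [b Hb] := exA d (kbase n v) (kt n q) (kd0 n (leqnn n)).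
have := kt n 0; rewrite Hb ktrunc_koszul_d ktrunc0 raddf0 -Hb => E.
by elim: (n) E => [/= <- //|m IH] [] /IH.
Qed.

Section BaseChange.
Variables (F : fieldType) (A : graded_family F) (n q : nat).
Local Notation D := {poly F}.
Local Notation L := {fraction {poly F}}.
Local Notation tof := (@FracField.tofrac D).
Local Notation "x %:F" := (tof x).
Local Notation iota := (tof \o polyC).

Definition fraction_act i d : 'M[L]_(gdim A d, gdim A d.+1) :=
  map_mx iota (gact A i d).

Fact fraction_actC i j d : fraction_act i d *m fraction_act j d.+1
  = fraction_act j d *m fraction_act i d.+1.
Proof. by rewrite -!map_mxM gactC. Qed.

Definition fraction_family : graded_family L :=
  GradedFamily fraction_actC (gdim0 A).

Lemma map_mx_injective (U W : Type) (f : U -> W) m k :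
  injective f -> injective (@map_mx U W f m k).
Proof.
move=> f_inj u v /matrixP E; apply/matrixP => i j; apply: f_inj.
by have := E i j; rewrite !mxE.
Qed.

Lemma tof_inj : injective tof.
Proof. by move=> p p' /eqP; rewrite tofrac_eq => /eqP. Qed.

Local Notation cf d k := (map_mx (coefp k) : 'rV[D]_(gdim A d) ->
  'rV[F]_(gdim A d)).
Definition mono d k (v : 'rV[F]_(gdim A d)) : 'rV[D]_(gdim A d) :=
  'X^k *: map_mx polyC v.

Fact mono_additive d k : zmod_morphism (@mono d k).
Proof. by move=> u v; rewrite /mono raddfB scalerBr. Qed.
HB.instance Definition _ d k := GRing.isZmodMorphism.Build _ _ _
  (@mono_additive d k).

Definition gop_poly d i : {additive 'rV[D]_(gdim A d) -> 'rV[D]_(gdim A d.+1)} :=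
  mulmxr (map_mx polyC (gact A i d)).

Lemma coef_gop_poly d k i v : gop A d i (cf d k v) = cf d.+1 k (gop_poly d i v).
Proof.
apply/rowP => j; rewrite !mxE /coefp coef_sum; apply: eq_bigr => a _.
by rewrite !mxE coefMC.
Qed.

Lemma gop_poly_mono d k i v : gop_poly d i (mono k v) = mono k (gop A d i v).
Proof. by rewrite /mono /= map_mxM scalemxAl. Qed.

Lemma tofrac_gop_poly d i v : gop fraction_family d i (map_mx tof v)
  = map_mx tof (gop_poly d i v).
Proof. by rewrite /= map_mxM -map_mx_comp. Qed.

(** A cochain has finitely many components, so one bound on the degrees in z
    serves for all of them. *)
Lemma koszul_coef_sum d m (c : koszul 'rV[D]_(gdim A d) m) :
  exists N, forall N', (N <= N')%N ->
    c = \sum_(k < N') kmap (@mono d k) (kmap (cf d k) c).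
Proof.
elim: m c => [|m IH] c /=.
  exists (\max_j size (c ord0 j)) => N' NN'.
  apply/rowP => j; rewrite summxE -[LHS]coefK poly_def.
  have le : (size (c ord0 j) <= N')%N by apply: leq_trans NN';
    exact: (leq_bigmax j).
  rewrite (big_ord_widen N' (fun i => (c 0 j)`_i *: 'X^i)) // big_mkcond /=.
  apply: eq_bigr => k _; rewrite !mxE /coefp mulrC mul_polyC.
  by case: ltnP => // /(nth_default 0)->; rewrite scale0r.
have [N1 H1] := IH c.1; have [N2 H2] := IH c.2.
exists (maxn N1 N2) => N'; rewrite geq_max => /andP[/H1 E1 /H2 E2].
have -> : c = (c.1, c.2) by case: (c).
rewrite {1}E1 {1}E2 /=; elim: N' {E1 E2} => [|N' IHN]; first by rewrite !big_ord0.
by rewrite !big_ord_recr /= -IHN.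
Qed.

(** Clear denominators, split a cocycle into its coefficients, each of which is
    a cocycle over F, and reassemble the primitives. *)
Lemma fraction_family_exact : koszul_exact A n q ->
  koszul_exact fraction_family n q.
Proof.
move=> exA d c cq dc.
pose T e : {additive 'rV[D]_(gdim A e) -> 'rV[L]_(gdim A e)} := map_mx tof.
have T_inj e m : injective (@kmap _ _ (T e) m).
  by apply: kmap_inj; apply: map_mx_injective; exact: tof_inj.
have [s [c' [s0 cc']]] := koszul_clear c.
have tof_kd e (b : koszul 'rV[D]_(gdim A e) n) :
    koszul_d (gop fraction_family e) (kmap (T e) b)
      = kmap (T e.+1) (koszul_d (gop_poly e) b).
  by apply: koszul_d_map => i v; exact: tofrac_gop_poly.
have sc_kd e (t : L) (b : koszul 'rV[L]_(gdim A e) n) :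
    koszul_d (gop fraction_family e) (kmap ( *:%R t) b)
      = kmap ( *:%R t) (koszul_d (gop fraction_family e) b).
  by apply: koszul_d_map => i v; rewrite /= scalemxAl.
have c'q : ktrunc q c' = c'.
  apply: (T_inj d.+1); rewrite -ktrunc_kmap -[kmap _ c']cc'.
  by rewrite (ktrunc_kmap ( *:%R s%:F)) cq.
have dc' : koszul_d (gop_poly d.+1) c' = 0.
  by apply: (T_inj d.+2); rewrite -tof_kd -[kmap _ c']cc' sc_kd dc !raddf0.
have ex k : exists b, kmap (cf d.+1 k) c' = koszul_d (gop A d) b.
  apply: exA; first by rewrite (ktrunc_kmap (map_mx (coefp k))) c'q.
  rewrite (koszul_d_map (x := gop_poly d.+1) (g :=
    map_mx (coefp k))) ?dc' ?raddf0 //.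
  by move=> i v; exact: coef_gop_poly.
have [N HN] := koszul_coef_sum c'.
have [b Hb] := fin_all_exists (fun k : 'I_N => ex k).
pose b' := \sum_(k < N) kmap (@mono d k) (b k).
have Hb' : c' = koszul_d (gop_poly d) b'.
  rewrite {1}(HN N (leqnn N)) raddf_sum; apply: eq_bigr => k _.
  rewrite Hb; apply/esym/(koszul_d_map (g := @mono d.+1 k)) => i v.
  exact: gop_poly_mono.
exists (kmap ( *:%R s%:F^-1) (kmap (T d) b')).
rewrite sc_kd tof_kd -Hb' -[kmap _ c']cc' kmap_comp kmap_id // => v /=.
by rewrite scalerA mulVf ?scale1r // tofrac_eq0.
Qed.

Definition generic_form d : 'M[L]_(gdim A d, gdim A d.+1) :=
  \sum_(i < n) ('X^i)%:F *: fraction_act i d.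

Lemma generic_formC i d :
  generic_form d *m fraction_act i d.+1 = fraction_act i d *m generic_form d.+1.
Proof.
rewrite mulmx_suml mulmx_sumr; apply: eq_bigr => j _.
by rewrite -scalemxAl -scalemxAr fraction_actC.
Qed.

Lemma generic_form_free d :
  (forall d (v : 'rV[F]_(gdim A d)),
    (forall i, (i < n)%N -> v *m gact A i d = 0) -> v = 0) ->
  row_free (generic_form d).
Proof.
move=> soc0; rewrite -kermx_eq0 -submx0.
apply/row_subP => r; rewrite submx0.
set v := row r _.
have vl : v *m generic_form d = 0 by rewrite -row_mul mulmx_ker row0.
have [s [v' [s0 vv']]] := @koszul_clear D _ 0 v.
rewrite /= in v' vv'.
suff v'0 : v' = 0.
  apply/eqP; rewrite -[v](scalerK (a := s%:F)) ?tofrac_eq0 //.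
  by rewrite vv' v'0 raddf0 scaler0.
have v'l : \sum_(i < n) 'X^i *: gop_poly d i v' = 0.
  apply: (map_mx_injective tof_inj); rewrite raddf0 raddf_sum.
  transitivity (s%:F *: (v *m generic_form d)); last by rewrite vl scaler0.
  rewrite scalemxAl vv' mulmx_sumr.
  apply: eq_bigr => i _; rewrite -scalemxAr /= map_mxZ /=.
  by rewrite map_mxM -map_mx_comp.
suff cf0 k : cf d k v' = 0.
  apply/rowP => j; apply/polyP => k.
  by have /rowP/(_ j) := cf0 k; rewrite !mxE coef0.
apply: (@mccoy _ A n soc0 (\max_j size (v' ord0 j)) d (fun k => cf d k v')).
  move=> {}k le; apply/rowP => j; rewrite !mxE /coefp nth_default //.
  by apply: leq_trans le; exact: (leq_bigmax j).
move=> m; apply/rowP => j.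
transitivity ((\sum_(i < n) 'X^i *: gop_poly d i v') ord0 j)`_m; last first.
  by rewrite v'l !mxE coef0.
rewrite !summxE coef_sum big_mkcond /= big_mkcond /=.
apply: eq_bigr => i _; rewrite [in RHS]mxE coefXnM ltnNge.
by case: leqP => //= _; have /rowP/(_ j) := coef_gop_poly (m - i) i v';
  rewrite !mxE.
Qed.
End BaseChange.

Definition diff (f : nat -> int) (d : nat) : int :=
  if d is d'.+1 then f d - f d' else f 0.

Lemma eq_diff q f g : f =1 g -> iter q diff f =1 iter q diff g.
Proof.
move=> fg; elim: q => [|q IH] //= [|d] /=; first exact: IH.
by rewrite !IH.
Qed.

(** Each exterior degree of exactness allows one more division by a generic
    linear form, and a dimension is nonnegative. *)
Theorem koszul_exact_diff_ge0 q (F : fieldType) (A : graded_family F) n :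
  koszul_exact A n q -> forall d, 0 <= iter q diff (fun e => (gdim A e)%:Z) d.
Proof.
elim: q F A => [|q IH] F A // exA d.
have exB := fraction_family_exact exA.
have free d' : row_free (generic_form A n d').
  by apply: generic_form_free; exact: koszul_exact_soc exA.
have := IH _ _ (@quotient_family_exact _ (fraction_family A) n q _
  (generic_formC A n) free exB) d.
rewrite iterSr (@eq_diff q _ (diff (fun e => (gdim A e)%:Z))) // => -[|e] /=.
  by rewrite gdim0.
by have := @quotient_family_dim _ (fraction_family A) _ (generic_formC A n)
  free e; rewrite /=; lia.
Qed.

(** * Graded modules over the polynomial ring *)

Lemma dep_choice (T : nat -> Type) (P : forall d, T d -> Prop) :
  (forall d, exists x, P d x) -> exists f : forall d, T d, forall d, P d (f d).
Proof.
move=> H; exists (fun d => proj1_sig (constructive_indefinite_description _ (H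
  d))).
by move=> d; case: constructive_indefinite_description.
Qed.

Section PolynomialVariables.
Variables (K : fieldType) (n : nat).
Local Notation S := {mpoly K[n]}.

(** Variables are indexed by natural numbers, with value 0 out of range, so that
    lists of variables and the operators of a Koszul complex need no bounds. *)
Definition mvar (i : nat) : S := if insub i is Some j then 'X_j else 0.

Lemma mvarE (i : 'I_n) : mvar i = 'X_i.
Proof. by rewrite /mvar valK. Qed.

Lemma mvar_homog i : mvar i \is 1.-homog.
Proof.
by rewrite /mvar; case: insub => [j|]; rewrite ?dhomog0 // dhomogX /= mdeg1.
Qed.

Lemma in_ideal_mul_vars k (p : S) :
  (k <= n)%N ->
  (forall m, m \in msupp p -> exists2 i : 'I_n, (i < k)%N & m i != 0%N) ->
  in_ideal_mul (mkseq mvar k) (p : S^o).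
Proof.
move=> kn pm; rewrite [p]mpolyE big_seq.
elim/big_rec: _ => [|m v /pm[i ik mi]]; first exact: in_ideal_mul0.
apply: in_ideal_mulD.
have -> : p@_m *: 'X_[m] = mvar i *: (p@_m *: 'X_[m - U_(i)] : S^o).
  have {2}-> : m = (m - U_(i) + U_(i))%MM by rewrite submK // lep1mP.
  rewrite -[RHS]/(mvar i * (p@_m *: 'X_[m - U_(i)])) mvarE.
  by rewrite mpolyXD [X in _ *: X]mulrC scalerAr.
by apply: in_ideal_mul_mem; apply: map_f; rewrite mem_iota.
Qed.

Lemma mcoeff0_in_vars (p : S) : p@_0%MM = 0 ->
  exists a : nat -> S, p = \sum_(i < n) a i * mvar i.
Proof.
move=> p0.
have /in_ideal_mulP[a pa] : in_ideal_mul (mkseq mvar n) (p : S^o).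
  apply: in_ideal_mul_vars => // m mp.
  have : m != 0%MM by apply: contraTneq mp => ->; rewrite mcoeff_msupp p0 eqxx.
  case: (pickP (fun i => m i != 0%N)) => [i mi _|m0]; first by exists i.
  by case/eqP; apply/mnmP => i; rewrite mnm0E; apply/eqP/negPn; rewrite m0.
exists a; rewrite {1}pa size_mkseq; apply: eq_bigr => i _.
by rewrite nth_mkseq // mulrC.
Qed.
End PolynomialVariables.

Section Homogeneous.
Variables (K : fieldType) (n : nat) (N : lmodType {mpoly K[n]}).
Variable gr : int -> N -> Prop.
Hypothesis grN : is_grading gr.
Local Notation S := {mpoly K[n]}.

Lemma grN_opp d v : gr d v -> gr d (- v).
Proof. by rewrite -sub0r; apply: (gradingB grN); exact: (grading0 grN). Qed.

Lemma grD d u v : gr d u -> gr d v -> gr d (u + v).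
Proof. by rewrite -[v in u + v]opprK => Gu /grN_opp; apply: (gradingB grN). Qed.

Lemma grX d i v : gr d v -> gr (d + 1) (mvar K n i *: v).
Proof. by move=> Gv; apply: (gradingZ grN) => //; exact: mvar_homog. Qed.

(** f lists the homogeneous components of v; being zero outside of a finite set
    of degrees makes f unique. *)
Definition decomposes (v : N) (f : int -> N) : Prop :=
  (forall e, gr e (f e)) /\
  exists ds : seq int, [/\ uniq ds, forall e, e \notin ds -> f e = 0
    & v = \sum_(e <- ds) f e].

(** The list of degrees provided by the grading may have repetitions: the
    component of a degree is then counted with multiplicity. *)
Lemma decomposes_ex v : exists f, decomposes v f.
Proof.
have [ds [f [grf ->]]] := grading_sum grN v.
exists (fun e => if e \in ds then f e *+ count_mem e ds else 0); split=> [e|].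
  case: ifP => _; last exact: (grading0 grN).
  elim: (count_mem _ _) => [|k IH]; first by rewrite mulr0n;
    exact: (grading0 grN).
  by rewrite mulrS; apply: grD.
exists (undup ds); split=> [|e|]; first exact: undup_uniq.
  by rewrite mem_undup => /negPf->.
rewrite -big_undup_iterop_count big_seq [RHS]big_seq; apply: eq_bigr => e.
by rewrite mem_undup => ->.
Qed.

Lemma sum_supportW (f : int -> N) (ds es : seq int) :
  uniq ds -> uniq es -> (forall e, e \notin ds -> f e = 0) ->
  {subset ds <= es} -> \sum_(e <- es) f e = \sum_(e <- ds) f e.
Proof.
move=> uds ues f0 sub.
rewrite (bigID (mem ds)) /= addrC big1; last by move=> ? /f0.
rewrite add0r -big_filter; apply: perm_big; apply: uniq_perm => //.
  by rewrite filter_uniq.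
by move=> a; rewrite mem_filter andb_idr // => /sub.
Qed.

Lemma decomposesB u v f g :
  decomposes u f -> decomposes v g -> decomposes (u - v) (fun e => f e - g e).
Proof.
move=> [grf [ds [uds f0 ->]]] [grg [es [ues g0 ->]]].
split=> [e|]; first exact: (gradingB grN).
exists (undup (ds ++ es)); split=> [|e|]; first exact: undup_uniq.
  by rewrite mem_undup mem_cat negb_or => /andP[/f0-> /g0->]; rewrite subrr.
by rewrite sumrB; congr (_ - _); apply/esym/sum_supportW;
  rewrite ?undup_uniq // => a; rewrite mem_undup mem_cat => ->; rewrite ?orbT.
Qed.

Lemma decomposes_uniq v f g : decomposes v f -> decomposes v g -> f =1 g.
Proof.
move=> vf vg e; apply/eqP; rewrite -subr_eq0; apply/eqP.
have [grd [ds [uds d0]]] := decomposesB vf vg; rewrite subrr => /esym sum0.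
by have [/(grading_direct grN uds grd sum0)|/d0] := boolP (e \in ds).
Qed.

Definition hcomp (d : int) (v : N) : N :=
  proj1_sig (constructive_indefinite_description _ (decomposes_ex v)) d.

Lemma hcomp_decomposes v : decomposes v (hcomp^~ v).
Proof. by rewrite /hcomp; case: constructive_indefinite_description. Qed.

Lemma hcompE v f : decomposes v f -> forall d, hcomp d v = f d.
Proof. by move=> vf d; exact: (decomposes_uniq (hcomp_decomposes v) vf). Qed.

Lemma hcomp_gr d v : gr d (hcomp d v).
Proof. by case: (hcomp_decomposes v). Qed.

Fact hcomp_additive d : zmod_morphism (hcomp d).
Proof.
move=> u v; apply: (hcompE (f := fun d => hcomp d u - hcomp d v)).
by apply: decomposesB; exact: hcomp_decomposes.
Qed.
HB.instance Definition _ d :=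
  GRing.isZmodMorphism.Build N N (hcomp d) (hcomp_additive d).

Lemma hcomp_id d v : gr d v -> hcomp d v = v.
Proof.
move=> Gv; rewrite (hcompE (f := fun e => if e == d then v else 0)) ?eqxx //.
split=> [e|]; first by case: eqP => [->|_] //; exact: (grading0 grN).
exists [:: d]; split=> // [e|]; first by rewrite inE => /negPf->.
by rewrite big_seq1 eqxx.
Qed.

Lemma hcompX d i v : hcomp (d + 1) (mvar K n i *: v) = mvar K n i *: hcomp d v.
Proof.
rewrite (hcompE (f := fun e => mvar K n i *: hcomp (e - 1) v)) ?addrK //.
split=> [e|]; first by rewrite -{1}[e](subrK 1); apply: grX; exact: hcomp_gr.
have [_ [ds [uds v0 Ev]]] := hcomp_decomposes v.
exists [seq e + 1 | e <- ds]; split.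
- by rewrite map_inj_uniq //; exact: addIr.
- move=> e ne; rewrite v0 ?scaler0 //; apply: contra ne => ein.
  by apply/mapP; exists (e - 1); rewrite ?subrK.
- rewrite big_map {1}Ev scaler_sumr; apply: eq_bigr => e _.
  by rewrite addrK.
Qed.

End Homogeneous.

Section FamilyOfModule.
Variables (K : fieldType) (n : nat) (N : lmodType {mpoly K[n]}).
Variable gr : int -> N -> Prop.
Hypothesis grN : is_grading gr.
Variable h : nat -> nat.
Hypothesis h0 : h 0 = 0%N.
Variable e : forall d, 'I_(h d) -> N.
Hypothesis e_span : forall d v, gr (d%:Z - 1) v <->
  exists c : {ffun 'I_(h d) -> K}, v = \sum_(i < h d) (c i)%:MP *: e i.
Hypothesis e_free : forall d (c : {ffun 'I_(h d) -> K}),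
  \sum_(i < h d) (c i)%:MP *: e i = 0 -> forall i, c i = 0.

(** [emb] identifies row vectors with the homogeneous elements of degree d - 1. *)
Definition emb d (v : 'rV[K]_(h d)) : N := \sum_i (v 0 i)%:MP *: e i.

Fact emb_additive d : zmod_morphism (@emb d).
Proof.
move=> u v; rewrite /emb -sumrB; apply: eq_bigr => i _.
by rewrite !mxE mpolyCB scalerBl.
Qed.
HB.instance Definition _ d :=
  GRing.isZmodMorphism.Build 'rV[K]_(h d) N (@emb d) (@emb_additive d).

Lemma emb_inj d : injective (@emb d).
Proof.
apply: raddf_inj => v v0; apply/rowP => i; rewrite mxE.
have := @e_free d [ffun i => v 0 i]; rewrite /emb in v0.
move=> /(_ _ i); rewrite ffunE; apply; rewrite -[RHS]v0.
by apply: eq_bigr => j _; rewrite ffunE.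
Qed.

Lemma gr_emb d v : gr (d%:Z - 1) v <-> exists u, v = @emb d u.
Proof.
rewrite e_span; split=> [[c ->]|[u ->]].
  by exists (\row_i c i); apply: eq_bigr => i _; rewrite mxE.
by exists [ffun i => u 0 i]; apply: eq_bigr => i _; rewrite ffunE.
Qed.

Lemma embZ d (a : K) (v : 'rV[K]_(h d)) : emb (a *: v) = a%:MP *: emb v.
Proof.
by rewrite scaler_sumr; apply: eq_bigr => i _; rewrite mxE mpolyCM scalerA.
Qed.

Lemma act_matrix_ex i d : exists X : 'M[K]_(h d, h d.+1),
  forall v, emb (v *m X) = mvar K n i *: emb v.
Proof.
have /fin_all_exists[X EX] : forall r : 'I_(h d), exists u : 'rV[K]_(h d.+1),
    mvar K n i *: emb (delta_mx 0 r) = emb u.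
  move=> r; apply/gr_emb; have -> : d.+1%:Z - 1 = d%:Z - 1 + 1 by lia.
  by apply: (grX grN); apply/gr_emb; exists (delta_mx 0 r).
exists (\matrix_r X r) => v.
rewrite mulmx_sum_row [v in RHS]row_sum_delta.
rewrite (raddf_sum (@emb d)) (raddf_sum (@emb d.+1)) scaler_sumr.
apply: eq_bigr => r _ /=; rewrite rowK !embZ -EX !scalerA.
by rewrite mulrC.
Qed.

(** The Koszul complex of the family of graded pieces is a graded piece of the
    Koszul complex of N.  Exactness descends to it because taking homogeneous
    components commutes with the variables. *)
Theorem regular_diff_ge0 (ys : seq {mpoly K[n]}) :
  (forall y, y \in ys -> y@_0%MM = 0) -> regular_sequence N ys ->
  forall d, 0 <= iter (size ys) diff (fun e => (h e)%:Z) d.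
Proof.
move=> ys0 [reg _].
have [X EX] := @dep_choice (fun=> forall d, 'M[K]_(h d, h d.+1))
  (fun i X => forall d v, emb (v *m X d) = mvar K n i *: emb v)
  (fun i => dep_choice (act_matrix_ex i)).
have XC i j d : X i d *m X j d.+1 = X j d *m X i d.+1.
  apply/row_matrixP => r; apply: emb_inj.
  by rewrite !rowE !mulmxA !EX !scalerA mulrC.
pose A := GradedFamily XC h0.
apply: (@koszul_exact_diff_ge0 _ _ A n) => d c cq dc.
have kd_emb k (b : koszul 'rV[K]_(h k) n) :
    koszul_d (fun i => *:%R (mvar K n i)) (kmap (@emb k) b)
      = kmap (@emb k.+1) (koszul_d (gop A k) b).
  by apply: koszul_d_map => i v; rewrite /= EX.
have [|//|||b] := @regular_koszul_exact _ N (mvar K n) n ys reg _ (size ys) 0 _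
  (kmap (@emb d.+1) c).
- by move=> y /ys0; exact: mcoeff0_in_vars.
- by rewrite ktrunc_kmap cq.
- rewrite kd_emb dc raddf0; apply: kall0; exact: in_ideal_mul0.
rewrite take0 => Hb.
have {}Hb : kmap (@emb d.+1) c = koszul_d (fun i => *:%R (mvar K n i)) b.
  apply/eqP; rewrite -subr_eq0; apply/eqP.
  by apply: kall_eq0; apply: kall_impl Hb => v [w ->]; rewrite big_ord0.
pose b1 : koszul N n := kmap (hcomp grN (d%:Z - 1)) b.
have Hb1 : kmap (@emb d.+1) c = koszul_d (fun i => *:%R (mvar K n i)) b1.
  rewrite /b1 (koszul_d_map (x := fun i => *:%R (mvar K n i)) (g :=
    hcomp grN d%:Z)).
    rewrite -Hb kmap_comp; apply: eq_kmap => v /=.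
    rewrite hcomp_id //; have -> : d%:Z = d.+1%:Z - 1 by lia.
    by apply/gr_emb; exists v.
  by move=> i v; rewrite -hcompX subrK.
have [b2 Hb2] : exists b2, b1 = kmap (@emb d) b2.
  by apply: kmap_lift => v; apply/gr_emb; exact: hcomp_gr.
exists b2; apply: (kmap_inj (@emb_inj d.+1)).
by rewrite Hb1 Hb2 kd_emb.
Qed.

End FamilyOfModule.

(** * Hilbert functions, depth and Hilbert depth *)

Section HilbertFunction.
Variables (K : fieldType) (n : nat).
Local Notation S := {mpoly K[n]}.

Definition hilbert_function (M : lmodType S) (gr : int -> M -> Prop)
    (H : nat -> nat) : Prop :=
  (forall d : nat, has_dim (gr d) (H d)) /\ (forall d, has_dim (gr (Negz d)) 0).

(** Expressing each basis in the other gives matrices whose product is the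
    identity, by freeness. *)
Lemma has_dim_le (M : lmodType S) (V : M -> Prop) k k' :
  has_dim V k -> has_dim V k' -> (k' <= k)%N.
Proof.
move=> [e [eV _]] [e' [eV' free']].
have comb (m : nat) (f : 'I_m -> M) i :
    f i = \sum_j ([ffun j => (j == i)%:R : K] j)%:MP *: f j.
  rewrite (bigD1 i) //= ffunE eqxx mpolyC1 scale1r big1 ?addr0 // => j ji.
  by rewrite ffunE (negPf ji) mpolyC0 scale0r.
have /fin_all_exists[A EA] j : exists c : {ffun 'I_k -> K},
    e' j = \sum_(i < k) (c i)%:MP *: e i.
  by apply/eV/eV'; eexists; exact: comb.
have /fin_all_exists[B EB] i : exists c : {ffun 'I_k' -> K},
    e i = \sum_(j < k') (c j)%:MP *: e' j.
  by apply/eV'/eV; eexists; exact: comb.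
apply: (@mulmx1_min _ _ _ (\matrix_(j, i) A j i) (\matrix_(i, j) B i j)).
apply/matrixP => j l; rewrite !mxE.
apply/eqP; rewrite -subr_eq0; apply/eqP.
pose c := [ffun l => \sum_i A j i * B i l - (j == l)%:R].
have := free' c; rewrite /c; set P := (X in X = 0 -> _) => /(_ _ l).
rewrite ffunE => E; rewrite -[RHS]E.
  by congr (_ - _); apply: eq_bigr => i _; rewrite !mxE.
rewrite /P; under eq_bigr do rewrite ffunE mpolyCB scalerBl.
rewrite sumrB; apply/eqP; rewrite subr_eq0; apply/eqP.
transitivity (e' j); last first.
  by rewrite {1}[e' j]comb; apply: eq_bigr => i _; rewrite ffunE eq_sym.
rewrite EA; under [RHS]eq_bigr do rewrite EB scaler_sumr.
rewrite exchange_big; apply: eq_bigr => m _ /=.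
rewrite raddf_sum scaler_suml; apply: eq_bigr => i _.
by rewrite scalerA -mpolyCM.
Qed.

Lemma has_dim_uniq (M : lmodType S) (V : M -> Prop) k k' :
  has_dim V k -> has_dim V k' -> k = k'.
Proof. by move=> Hk Hk'; apply/eqP; rewrite eqn_leq !(has_dim_le Hk Hk',
  has_dim_le Hk' Hk). Qed.

Lemma hilbert_function_same (M N : lmodType S) (grM : int -> M -> Prop)
    (grN : int -> N -> Prop) H :
  @same_hilbert_series K n M grM N grN ->
  hilbert_function grM H -> hilbert_function grN H.
Proof.
move=> same [Hp Hn]; split=> d.
  by have [k [kM kN]] := same d%:Z; rewrite (has_dim_uniq (Hp d) kM).
by have [k [kM kN]] := same (Negz d); rewrite (has_dim_uniq (Hn d) kM).
Qed.

Lemma same_hilbert_function (M N : lmodType S) (grM : int -> M -> Prop)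
    (grN : int -> N -> Prop) H :
  hilbert_function grM H -> hilbert_function grN H ->
  @same_hilbert_series K n M grM N grN.
Proof.
by move=> [Mp Mn] [Np Nn] [d|d]; [exists (H d)|exists 0%N].
Qed.

Definition delay (T : Type) (x0 : T) (f : nat -> T) d :=
  if d is d'.+1 then f d' else x0.

Lemma iter_diff_delay q f d :
  iter q diff (delay 0 f) d = delay 0 (iter q diff f) d.
Proof.
by elim: q d => [|q IH] [|[|d]] //=; rewrite !IH //= subr0.
Qed.

Theorem depth_diff_ge0 (N : lmodType S) (gr : int -> N -> Prop) H (ys : seq S) :
  is_grading gr -> hilbert_function gr H ->
  (forall y, y \in ys -> y@_0%MM = 0) -> regular_sequence N ys ->
  forall d, 0 <= iter (size ys) diff (fun e => (H e)%:Z) d.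
Proof.
move=> grN [Hp Hn] ys0 reg d.
pose h := delay 0%N H.
have dims k : has_dim (gr (k%:Z - 1)) (h k).
  case: k => [|k]; first exact: (Hn 0).
  by have -> : k.+1%:Z - 1 = k%:Z by lia.
have [e He] := dep_choice dims.
have := @regular_diff_ge0 K n N gr grN h erefl e
  (fun k => (He k).1) (fun k => (He k).2) ys ys0 reg d.+1.
rewrite (@eq_diff _ _ (delay 0 (fun e => (H e)%:Z))) ?iter_diff_delay //.
by case.
Qed.

(** In degree c+1, positivity of the q-th difference becomes a bound on q. *)
Lemma iter_diff_bottom q f c : (forall d, (d < c)%N -> f d = 0) ->
  [/\ forall d, (d < c)%N -> iter q diff f d = 0,
      iter q diff f c = f c & iter q diff f c.+1 = f c.+1 - q%:Z * f c].
Proof.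
move=> f0; elim: q => [|q [IH0 IH1 IH2]] /=; first by rewrite mul0r subr0.
split.
- by case=> [|d] lt /=; rewrite !IH0 ?subr0 // ltnW.
- by case: c f0 IH0 IH1 {IH2} => //= c f0 IH0 ->; rewrite IH0 ?subr0.
- by rewrite IH1 IH2; lia.
Qed.

Lemma regular_size_le (N : lmodType S) (gr : int -> N -> Prop) H (ys : seq S) c :
  is_grading gr -> hilbert_function gr H ->
  (forall d, (d < c)%N -> H d = 0%N) -> (0 < H c)%N ->
  (forall y, y \in ys -> y@_0%MM = 0) -> regular_sequence N ys ->
  (size ys <= H c.+1)%N.
Proof.
move=> grN HN Hlt Hc ys0 reg; have := depth_diff_ge0 grN HN ys0 reg c.+1.
have [|_ _ ->] := @iter_diff_bottom (size ys) (fun e => (H e)%:Z) c.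
  by move=> d /Hlt ->.
by nia.
Qed.

End HilbertFunction.

(** The choice made by [max_nat] is meaningful on nonempty bounded sets. *)
Lemma max_natP (P : nat -> Prop) B : (exists m, P m) ->
  (forall m, P m -> (m <= B)%N) ->
  P (max_nat P) /\ forall k, P k -> (k <= max_nat P)%N.
Proof.
move=> [m Pm] PB; apply: (epsilon_spec (inhabits 0%N)
  (fun m => P m /\ forall k, P k -> (k <= m)%N)).
have [k le] : exists k, (B - m <= k)%N by exists (B - m)%N.
elim: k m Pm le => [|k IH] m Pm le.
  by exists m; split=> // j /PB; move: (PB _ Pm); lia.
have [[j Pj lt]|none] := classic (exists2 j, P j & (m < j)%N).
  by apply: (IH j) => //; move: (PB _ Pj); lia.
exists m; split=> // j Pj; rewrite leqNgt; apply/negP => lt.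
by apply: none; exists j.
Qed.

Section HilbertDepth.
Variables (K : fieldType) (n : nat).
Local Notation S := {mpoly K[n]}.
Local Notation vars D := (mkseq (mvar K n) D).

(** The cancellation half of regularity, which passes to direct sums and holds
    for the zero module. *)
Definition weakly_regular (M : lmodType S) (xs : seq S) : Prop :=
  forall i, (i < size xs)%N -> forall v : M,
    in_ideal_mul (take i xs) (xs`_i *: v) -> in_ideal_mul (take i xs) v.

(** H is the Hilbert function of a module on which the first D variables can be
    cancelled successively. *)
Definition realizable (D : nat) (H : nat -> nat) : Prop :=
  exists (N : lmodType S) (gr : int -> N -> Prop),
    [/\ is_grading gr, finitely_generated N, hilbert_function gr H
      & weakly_regular N (vars D)].

Lemma has_dim0 (M : lmodType S) (V : M -> Prop) v : has_dim V 0 -> V v -> v = 0.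
Proof. by move=> [e [eV _]] /eV[c ->]; rewrite big_ord0. Qed.

Lemma has_dim_neq0 (M : lmodType S) (V : M -> Prop) k : (0 < k)%N ->
  has_dim V k -> exists2 v, V v & v <> 0.
Proof.
case: k => // k _ [e [eV free]].
pose c := [ffun i : 'I_k.+1 => (i == ord0)%:R : K].
exists (\sum_(i < k.+1) (c i)%:MP *: e i); first by apply/eV; exists c.
by move/free/(_ ord0)/eqP; rewrite ffunE eqxx oner_eq0.
Qed.

Section Bottom.
Variables (N : lmodType S) (gr : int -> N -> Prop) (H : nat -> nat) (c : nat).
Hypotheses (grN : is_grading gr) (HN : hilbert_function gr H).
Hypotheses (Hlt : forall d, (d < c)%N -> H d = 0%N) (Hc : (0 < H c)%N).

(** A nonzero element of lowest degree is not a combination of multiples of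
    variables. *)
Lemma weakly_regular_vars D : weakly_regular N (vars D) ->
  regular_sequence N (vars D).
Proof.
move=> wr; split=> //; have [v grv v0] := has_dim_neq0 Hc (HN.1 c).
exists v => /in_ideal_mulP[w vw]; apply: v0.
have gr0 u : gr (c%:Z - 1) u -> u = 0.
  case: (c) Hlt => [|c'] Hlt'; first exact: has_dim0 (HN.2 0).
  have -> : c'.+1%:Z - 1 = c'%:Z by lia.
  by apply: has_dim0; rewrite -(Hlt' c') //; exact: (HN.1 c').
rewrite -(hcomp_id grN grv) vw raddf_sum big1 // => i _ /=.
rewrite nth_mkseq; last by case: (i) => j /=; rewrite size_mkseq.
rewrite -[c%:Z](subrK 1) hcompX (gr0 (hcomp _ _ _)) ?scaler0 //.
exact: hcomp_gr.
Qed.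

(** The empty sequence is regular, and the dimension just above the lowest degree
    bounds the length of any regular sequence. *)
Lemma depthP :
  (exists ys : seq S, [/\ size ys = depth N, forall y, y \in ys -> y@_0%MM = 0
     & regular_sequence N ys]) /\
  forall ys : seq S, (forall y, y \in ys -> y@_0%MM = 0) ->
    regular_sequence N ys -> (size ys <= depth N)%N.
Proof.
pose P d := exists xs : seq S, [/\ size xs = d, (forall x, x \in xs ->
  x@_0%MM = 0)
      & regular_sequence N xs].
have [||Pm mP] := @max_natP P (H c.+1).
- by exists 0%N, [::]; split=> //; apply: (@weakly_regular_vars 0) => i.
- by move=> m [ys [<- ys0 reg]]; exact: (regular_size_le grN HN Hlt Hc ys0 reg).
by split=> // ys ys0 reg; apply: mP; exists ys.
Qed.

Lemma depth_le : (depth N <= H c.+1)%N.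
Proof.
have [[ys [<- ys0 reg]] _] := depthP.
exact: (regular_size_le grN HN Hlt Hc ys0 reg).
Qed.

Lemma mvar_coef0 i : (mvar K n i)@_0%MM = 0.
Proof.
rewrite /mvar; case: insub => [j|]; last exact: mcoeff0.
by rewrite mcoeffX; case: eqP => // /mnmP/(_ j); rewrite mnm1E mnm0E eqxx.
Qed.

Lemma depth_vars_ge D : weakly_regular N (vars D) -> (D <= depth N)%N.
Proof.
move=> wr; rewrite -[X in (X <= _)%N](size_mkseq (mvar K n) D).
apply: depthP.2; last exact: weakly_regular_vars.
by move=> y /mapP[i _ ->]; exact: mvar_coef0.
Qed.
End Bottom.

Variables (M : lmodType S) (grM : int -> M -> Prop) (H : nat -> nat) (c : nat).
Hypothesis HM : hilbert_function grM H.
Hypotheses (Hlt : forall d, (d < c)%N -> H d = 0%N) (Hc : (0 < H c)%N).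

(** The hypothesis provides one module with the Hilbert function H; as depths
    are bounded in terms of H, the Hilbert depth is attained by some module. *)
Lemma hdepthP : realizable 0 H ->
  (forall d, 0 <= iter (hdepth grM) diff (fun e => (H e)%:Z) d) /\
  forall D, realizable D H -> (D <= hdepth grM)%N.
Proof.
move=> real0.
pose P d := exists (N : lmodType S) (grN : int -> N -> Prop),
    [/\ is_grading grN, finitely_generated N,
        same_hilbert_series grM grN & depth N = d].
have realP D : realizable D H -> exists2 d, P d & (D <= d)%N.
  move=> [N [gr [grN fg HN wr]]]; exists (depth N);
    last exact: (depth_vars_ge grN HN Hlt Hc wr).
  by exists N, gr; split=> //; exact: same_hilbert_function HM HN.
have [||[N [gr [grN fg same dN]]] mP] := @max_natP P (H c.+1).
- by have [d Pd _] := realP _ real0; exists d.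
- move=> m [N [gr [grN fg same <-]]].
  by apply: depth_le grN (hilbert_function_same same HM) Hlt Hc.
split=> [d|D /realP[d Pd le]]; last exact: leq_trans le (mP _ Pd).
have HN := hilbert_function_same same HM.
have [[ys [sy ys0 reg]] _] := depthP grN HN Hlt Hc.
by rewrite /hdepth -/P -dN -sy; exact: (depth_diff_ge0 grN HN ys0 reg d).
Qed.

End HilbertDepth.

(** * Counting monomials *)

Section Monomials.
Variable n : nat.
Implicit Types (m : 'X_{1..n}) (A : {set 'I_n}) (P : pred 'X_{1..n}).

Definition monos (d : nat) : seq 'X_{1..n} :=
  map (@bmnm n d.+1) [seq b : 'X_{1..n < d.+1} <- enum {: 'X_{1..n < d.+1}} |
    mdeg b == d].

Lemma mem_monos d m : (m \in monos d) = (mdeg m == d).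
Proof.
apply/mapP/idP => [[m']|md]; first by rewrite mem_filter => /andP[+ _] ->.
have lt : (mdeg m < d.+1)%N by rewrite (eqP md).
by exists (BMultinom lt) => //; rewrite mem_filter md mem_enum.
Qed.

Lemma uniq_monos d : uniq (monos d).
Proof.
rewrite map_inj_uniq; first exact: (filter_uniq _ (enum_uniq _)).
by move=> b1 b2 b12; exact: val_inj.
Qed.

Definition count_monos P d := count P (monos d).

Lemma eq_count_monos P Q d : (forall m, mdeg m = d -> P m = Q m) ->
  count_monos P d = count_monos Q d.
Proof. by move=> PQ; apply: eq_in_count => m; rewrite mem_monos => /eqP /PQ. Qed.

Lemma count_monosID P Q d : count_monos P d = (count_monos (predI P Q) d +
  count_monos (predI P (predC Q)) d)%N.
Proof.
rewrite /count_monos -!size_filter -(count_predC Q) -!size_filter -!filter_predI.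
by congr (_ + _)%N; congr size; apply: eq_filter => m /=; rewrite andbC.
Qed.

Lemma count_monos_shift P (i : 'I_n) d :
  count_monos (fun m => P m && (m i != 0%N)) d.+1 = count_monos (fun m =>
    P (m + U_(i))%MM) d.
Proof.
rewrite /count_monos -size_filter.
have /perm_size -> : perm_eq [seq m <- monos d.+1 | P m && (m i != 0%N)]
    [seq (m + U_(i))%MM | m <- monos d & P (m + U_(i))%MM].
  apply: uniq_perm; rewrite ?filter_uniq ?uniq_monos //.
    by rewrite map_inj_uniq ?filter_uniq ?uniq_monos //; exact: addIm.
  move=> m; rewrite mem_filter mem_monos; apply/idP/mapP.
    move=> /andP[/andP[Pm mi] /eqP md]; exists (m - U_(i))%MM; last first.
      by rewrite submK // lep1mP.
    rewrite mem_filter submK ?lep1mP // Pm mem_monos.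
    have := mdegD (m - U_(i))%MM U_(i)%MM;
      rewrite submK ?lep1mP // mdeg1 md addn1.
    by move=> -[->]; rewrite eqxx.
  move=> [m']; rewrite mem_filter mem_monos => /andP[Pm /eqP md] ->.
  by rewrite Pm mdegD mdeg1 md addn1 eqxx mnmDE mnm1E eqxx addn1.
by rewrite size_map size_filter.
Qed.

Definition msuppset m : {set 'I_n} := [set i | m i != 0%N].

End Monomials.

(** The number of monomials of degree d in j variables. *)
Fixpoint num_monos (j : nat) : nat -> nat :=
  if j is j'.+1 then fix f d := if d is d'.+1 then (num_monos j' d + f d')%N
    else 1%N
  else fun d => (d == 0)%N.

Lemma num_monosS j d : num_monos j.+1 d.+1 = (num_monos j d.+1 + num_monos j.+1
  d)%N. Proof. by []. Qed.
Lemma num_monos0 j : num_monos j 0 = 1%N. Proof. by case: j. Qed.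

Lemma iter_delayE (T : Type) (x0 : T) f j d :
  iter j (delay x0) f d = if (j <= d)%N then f (d - j)%N else x0.
Proof.
by elim: j d => [|j IH] [|d] //=; rewrite ?subn0 // IH.
Qed.

Lemma iter_delay_num_monosS j d :
  iter j.+1 (delay 0%N) (num_monos j.+1) d.+1 =
  (iter j (delay 0%N) (num_monos j) d + iter j.+1 (delay 0%N) (num_monos j.+1)
    d)%N.
Proof.
rewrite !iter_delayE ltnS; case: (ltngtP j d) => [lt|gt|->].
- by rewrite subSS -[(d - j)%N](subnSK lt) num_monosS.
- by [].
- by rewrite subSS subnn !num_monos0.
Qed.

Section MonomialCounts.
Variable n : nat.
Implicit Types (m : 'X_{1..n}) (A : {set 'I_n}) (P : pred 'X_{1..n}).

Lemma count_monos_deg0 P : count_monos P 0 = P 0%MM :> nat.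
Proof.
rewrite /count_monos -[RHS]addn0 -[RHS]/(count P [:: 0%MM]);
  apply/permP/uniq_perm => //.
  exact: uniq_monos.
by move=> m; rewrite mem_monos mdeg_eq0 inE.
Qed.

Lemma msuppset0 : msuppset (0%MM : 'X_{1..n}) = set0.
Proof. by apply/setP => i; rewrite !inE mnm0E. Qed.

Lemma count_monos_subset A d : count_monos (fun m =>
  msuppset m \subset A) d = num_monos #|A| d.
Proof.
move Ej: #|A| => j; elim: j A Ej d => [|j IH] A cA d.
  move/eqP: cA; rewrite cards_eq0 => /eqP ->.
  case: d => [|d]; first by rewrite count_monos_deg0 subset0 msuppset0 eqxx.
  rewrite /= /count_monos; apply/eqP; rewrite -leqn0 leqNgt -has_count;
    apply/hasP.
  move=> [m]; rewrite mem_monos subset0 => /eqP md /eqP m0.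
  suff: m = 0%MM by move=> E; move: md; rewrite E mdeg0.
  by apply/mnmP => i; move/setP/(_ i): m0; rewrite !inE mnm0E => /negbFE/eqP.
elim: d => [|d IHd]; first by rewrite count_monos_deg0 msuppset0 sub0set.
have /card_gt0P[i iA] : (0 < #|A|)%N by rewrite cA.
rewrite num_monosS (count_monosID _ (fun m => m i != 0%N)) addnC;
  congr (_ + _)%N; last first.
  rewrite -IHd; apply: etrans (count_monos_shift _ i d) _;
    apply: eq_count_monos => m _.
  apply/subsetP/subsetP => H k; have := H k; rewrite !inE mnmDE mnm1E.
    by move=> Hk mk; apply: Hk; rewrite addn_eq0 negb_and mk.
  by move=> Hk; case: (i =P k) => [<- //|_]; rewrite addn0.
rewrite -(IH (A :\ i)); last by move: (cardsD1 i A); rewrite iA cA => -[].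
apply: eq_count_monos => m _ /=; rewrite negbK subsetD1 inE; congr (_ && _).
by rewrite negbK.
Qed.

Lemma count_monos_all d : count_monos (predT : pred 'X_{1..n}) d = num_monos n d.
Proof.
have := count_monos_subset [set: 'I_n] d; rewrite cardsT card_ord => <-;
  apply: eq_count_monos => m _.
by rewrite subsetT.
Qed.

(** Dividing by the product of the variables in A turns the monomials with
    support A into all monomials in these variables, |A| degrees lower. *)
Lemma count_monos_support A d :
  count_monos (fun m => msuppset m == A) d = iter #|A| (delay 0%N) (num_monos
    #|A|) d.
Proof.
move Ej: #|A| => j; elim: j A Ej d => [|j IH] A cA d.
  move/eqP: (cA); rewrite cards_eq0 => /eqP -> /=.
  rewrite -/(num_monos 0 d) -(cards0 'I_n) -count_monos_subset;
    apply: eq_count_monos => m _.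
  by rewrite subset0.
have /card_gt0P[i iA] : (0 < #|A|)%N by rewrite cA.
elim: d => [|d IHd].
  rewrite count_monos_deg0 /=; case: eqP => // /setP/(_ i).
  by rewrite iA inE mnm0E.
have AiD : #|A :\ i| = j by move: (cardsD1 i A); rewrite iA cA => -[].
transitivity (count_monos (fun m => (msuppset m == A) && (m i != 0%N)) d.+1).
  apply: eq_count_monos => m _; case: eqP => //= mA; apply/esym.
  by move/setP/(_ i): mA; rewrite iA inE.
rewrite (count_monos_shift (fun m => msuppset m == A)).
rewrite (count_monosID _ (fun m => m i != 0%N)).
have -> : count_monos (predI (fun m => msuppset (m + U_(i))%MM == A) (fun m =>
  m i != 0%N)) d
    = iter j.+1 (delay 0%N) (num_monos j.+1) d.
  rewrite -IHd; apply: eq_count_monos => m _ /=; apply/andP/eqP.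
    move=> [/eqP/setP H mi]; apply/setP => k; rewrite -H !inE mnmDE mnm1E.
    by case: (i =P k) => [<-|]; rewrite ?addn0 // addn1 mi.
  move=> H; have mi : m i != 0%N by move/setP/(_ i): H; rewrite iA inE.
  split=> //; rewrite -H; apply/eqP/setP => k; rewrite !inE mnmDE mnm1E.
  by case: (i =P k) => [<-|]; rewrite ?addn0 // addn1 mi.
have -> : count_monos (predI (fun m => msuppset (m + U_(i))%MM == A) (predC
  (fun m => m i != 0%N))) d
    = iter j (delay 0%N) (num_monos j) d.
  rewrite -(IH _ AiD); apply: eq_count_monos => m _ /=; rewrite negbK;
    apply/andP/eqP.
    move=> [/eqP/setP H /eqP mi]; apply/setP => k;
      rewrite in_setD1 -H !inE mnmDE mnm1E [k == i]eq_sym.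
    by case: (i =P k) => [<-|]; rewrite ?addn0 //= ?mi.
  move=> H; have mi : m i = 0%N by move/setP/(_ i): H; rewrite !inE eqxx =>
    /negbFE/eqP.
  split; last exact/eqP; apply/eqP/setP => k; move/setP/(_ k): H.
  rewrite !inE mnmDE mnm1E [k == i]eq_sym.
  by case: (i =P k) => [<- _|_]; rewrite ?addn1 ?iA ?addn0.
by rewrite addnC -iter_delay_num_monosS.
Qed.

End MonomialCounts.

(** * Hilbert functions of a squarefree monomial ideal and its quotient *)

Section Bases.
Variables (K : fieldType) (n : nat).
Local Notation S := {mpoly K[n]}.

Lemma has_dim_seq (T : eqType) (s : seq T) (M : lmodType S) (V : M -> Prop)
    (f : T -> M) :
  uniq s ->
  (forall v, V v <-> exists c : T -> K, v = \sum_(t <- s) (c t)%:MP *: f t) ->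
  (forall c : T -> K, \sum_(t <- s) (c t)%:MP *: f t = 0 ->
     forall t, t \in s -> c t = 0) ->
  has_dim V (size s).
Proof.
case: s => [|t0 s'] us Vs free.
  exists (fun=> 0); split=> [v|c _ []//]; rewrite Vs.
  split=> [[c ->]|[c0 ->]]; first by exists [ffun=> 0]; rewrite big_ord0 big_nil.
  by exists (fun=> 0); rewrite big_ord0 big_nil.
set s := t0 :: s' in us Vs free *.
have E (c : {ffun 'I_(size s) -> K}) : \sum_(i < size s) (c i)%:MP *: f (nth t0
  s i) =
    \sum_(t <- s) (c (inord (index t s)))%:MP *: f t.
  rewrite [RHS](big_nth t0) big_mkord; apply: eq_bigr => i _.
  by rewrite index_uniq // inord_val.
exists (fun i => f (nth t0 s i)); split=> [v|c].
  rewrite Vs; split=> [[c ->]|[c ->]]; last by rewrite E; eexists.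
  exists [ffun i : 'I_(size s) => c (nth t0 s i)]; rewrite E !big_seq.
  apply: eq_bigr => t ts; rewrite ffunE inordK ?nth_index // ltnS.
  by rewrite -ltnS index_mem.
rewrite E => /(free (fun t => c (inord (index t s)))) H i.
have := H (nth t0 s i) (mem_nth _ (ltn_ord i)).
by rewrite index_uniq // inord_val.
Qed.

Lemma mcoeff_sum_monos (s : seq 'X_{1..n}) (c : 'X_{1..n} -> K) k : uniq s ->
  (\sum_(m <- s) (c m)%:MP * 'X_[m])@_k = if k \in s then c k else 0.
Proof.
move=> us; rewrite raddf_sum /=.
under eq_bigr do rewrite mcoeffCM mcoeffX.
case: ifP => ks.
  rewrite (bigD1_seq k) //= eqxx mulr1 big1 ?addr0 // => m mk.
  by rewrite (negPf mk) mulr0.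
rewrite big1_seq // => m /andP[_ ms]; case: eqP => [mk|]; last by rewrite mulr0.
by rewrite -mk ms in ks.
Qed.

Lemma homog_sum_monos d (p : S) : p \is d.-homog ->
  p = \sum_(m <- monos n d) (p@_m)%:MP * 'X_[m].
Proof.
move=> pd; apply/mpolyP => k; rewrite mcoeff_sum_monos ?uniq_monos // mem_monos.
by case: ifP => // /negbT koszul_d; rewrite (dhomog_nemf_coeff pd).
Qed.

Lemma sum_monos_homog d (P : pred 'X_{1..n}) (c : 'X_{1..n} -> K) :
  \sum_(m <- monos n d | P m) (c m)%:MP * 'X_[m] \is d.-homog.
Proof.
rewrite big_seq_cond; apply: rpred_sum => m /andP[md _].
by rewrite mul_mpolyC dhomogZ // dhomogX -mem_monos.
Qed.

Lemma poly_grading_hilbert : hilbert_function (@poly_grading K n : int ->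
  S^o -> Prop) (num_monos n).
Proof.
split=> d; last first.
  exists (fun=> 0); split=> [v|c _ [] //].
  by split=> [->|[c0 ->]]; [exists [ffun=> 0];
    rewrite big_ord0 | rewrite big_ord0].
rewrite -(count_monos_all n d) /count_monos count_predT.
apply: (@has_dim_seq _ (monos n d) _ _ (fun m => 'X_[m] : S^o)) => [|v|c].
- exact: uniq_monos.
- split=> [/homog_sum_monos vd|[c ->]]; last exact: (sum_monos_homog d predT).
  by exists (fun m => v@_m).
- move=> E m md; have := mcoeff_sum_monos c m (uniq_monos n d).
  by rewrite md [X in X@_m]E mcoeff0 => <-.
Qed.

End Bases.

Section MonomialIdeal.
Variables (K : fieldType) (n : nat) (I : idealr {mpoly K[n]}).
Local Notation S := {mpoly K[n]}.

Definition is_stanley_reisner (F : {set {set 'I_n}}) : Prop :=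
  (forall A B : {set 'I_n}, A \subset B -> B \in F -> A \in F) /\
  forall p : S, p \in I <-> forall m, m \in msupp p -> msuppset m \notin F.

Lemma msupp_mulX (p : S) g m : m \in msupp (p * 'X_[g]) -> (g <= m)%MM.
Proof.
rewrite [p]mpolyE mulr_suml => /msupp_sum_le /flattenP[s /mapP[k _ ->]].
rewrite -scalerAl -mpolyXD => /msuppZ_le; rewrite msuppX inE => /eqP ->.
exact: lem_addl.
Qed.

(** A monomial lies in I when its support contains the support of a generator.
    In characteristic p, a generator listed a multiple of p times contributes
    nothing to the combinations that make up I, and has to be dropped. *)
Lemma squarefree_stanley_reisner : squarefree_monomial_ideal I ->
  exists F, is_stanley_reisner F.
Proof.
move=> [G [Gsf GI]].
pose good g := (g \in G) && ((count_mem g G)%:R != 0 :> K).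
have GE (c : 'X_{1..n} -> S) : \sum_(g <- G) c g * 'X_[g] =
    \sum_(g <- undup G) (count_mem g G)%:R *: (c g * 'X_[g]).
  by rewrite -big_undup_iterop_count; apply: eq_bigr => g _; rewrite scaler_nat.
have leE g m : g \in G -> (g <= m)%MM = (msuppset g \subset msuppset m).
  move=> gG; apply/mnm_lepP/subsetP => H i.
    by rewrite !inE -!lt0n => /leq_trans; apply.
  have := H i; rewrite !inE; have := Gsf _ gG i.
  by case: (g i) => [|[|//]] // _ /(_ isT); rewrite lt0n.
have GinI g : good g -> 'X_[g] \in I.
  move=> /andP[gG g0]; apply/GI.
  exists (fun g' => if g' == g then (count_mem g G)%:R^-1%:MP else 0).
  rewrite GE (bigD1_seq g) ?undup_uniq ?mem_undup //= eqxx.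
  rewrite mul_mpolyC scalerA mulfV // scale1r big1 ?addr0 // => g' /negPf->.
  by rewrite mul0r scaler0.
exists [set A : {set 'I_n} | ~~ has (fun g =>
  good g && (msuppset g \subset A)) G]; split.
  move=> A B AB; rewrite !inE; apply: contra => /hasP[g gG /andP[gg gA]].
  by apply/hasP; exists g => //; rewrite gg (subset_trans gA AB).
move=> p; split=> [/GI[c ->] m|H].
  rewrite GE => /msupp_sum_le /flattenP[s /mapP[g + ->]].
  rewrite mem_filter mem_undup /= => gG mg; rewrite inE negbK; apply/hasP.
  exists g => //; rewrite /good gG /= -leE //; apply/andP; split.
    by apply: contraTneq mg => ->; rewrite scale0r msupp0.
  by apply: msupp_mulX; apply: msuppZ_le mg.
rewrite [p]mpolyE big_seq rpred_sum // => m /H; rewrite inE negbK.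
case/hasP => g gG /andP[gg]; rewrite -leE // => gm.
by rewrite -(submK gm) mpolyXD scalerAl idealMr // GinI.
Qed.

Section Complex.
Variable F : {set {set 'I_n}}.
Hypothesis FI : is_stanley_reisner F.

Lemma count_monos_supports (G : {set {set 'I_n}}) d :
  count_monos (fun m => msuppset m \in G) d =
  \sum_(A in G) iter #|A| (delay 0%N) (num_monos #|A|) d.
Proof.
rewrite /count_monos -sum1_count (partition_big (@msuppset n) (mem G)) //=.
apply: eq_bigr => A AG; rewrite -count_monos_support /count_monos -sum1_count.
by apply: eq_bigl => m; case: eqP => [->|]; rewrite ?AG ?andbF.
Qed.

Lemma monomial_in_ideal m : ('X_[m] \in I) = (msuppset m \notin F).
Proof.
apply/idP/idP => [/FI.2 H|H]; first by apply: H; rewrite msuppX inE.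
by apply/FI.2 => m'; rewrite msuppX inE => /eqP ->.
Qed.

Lemma ideal_hilbert : hilbert_function (@ideal_grading K n I)
  (fun d => \sum_(A in ~: F) iter #|A| (delay 0%N) (num_monos #|A|) d)%N.
Proof.
split=> d; last first.
  exists (fun=> 0); split=> [v|c _ [] //]; rewrite /ideal_grading /=;
    split=> [v0|[c ->]].
    by exists [ffun=> 0]; rewrite big_ord0; exact: val_inj.
  by rewrite big_ord0.
rewrite -count_monos_supports /count_monos -size_filter; set s := filter _ _.
have us : uniq s by rewrite filter_uniq // uniq_monos.
pose f m : ideal_module I := odflt 0 (insub 'X_[m]).
have vf m : m \in s -> val (f m) = 'X_[m].
  rewrite mem_filter inE -monomial_in_ideal => /andP[mI _].
  by rewrite /f insubT.
have val_sum (c : 'X_{1..n} -> K) : val (\sum_(m <- s) (c m)%:MP *: f m) =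
    \sum_(m <- s) (c m)%:MP * 'X_[m].
  rewrite raddf_sum /= big_seq [RHS]big_seq; apply: eq_bigr => m ms.
  by rewrite -vf.
apply: (@has_dim_seq K n _ s _ _ f us) => [v|c E m ms].
  split=> [vd|[c ->]].
    exists (fun m => (val v)@_m); apply: val_inj; rewrite val_sum.
    rewrite {1}(homog_sum_monos vd) big_filter [RHS]big_mkcond /=.
    apply: eq_bigr => m _; rewrite inE; case: ifP => // mF.
    suff -> : (val v)@_m = 0 by rewrite mpolyC0 mul0r.
    apply/eqP; rewrite mcoeff_eq0; apply: contraFN mF.
    exact: (FI.2 (val v)).1 (valP v) m.
  rewrite /ideal_grading val_sum big_filter; exact: sum_monos_homog.
have := mcoeff_sum_monos c m us.
by rewrite ms -val_sum E mcoeff0.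
Qed.

Lemma quotient_projD : {morph @quotient_proj _ I : p q / p + q}.
Proof. by move=> p q; rewrite /quotient_proj rmorphD. Qed.

Lemma quotient_proj_eq0 p : (quotient_proj I p == 0) = (p \in I).
Proof.
have -> : 0 = quotient_proj I 0 by rewrite /quotient_proj rmorph0.
by rewrite -[p in RHS]subr0 Quotient.idealrBE.
Qed.

Lemma quotient_proj_sum (s : seq 'X_{1..n}) (c : 'X_{1..n} -> K) :
  quotient_proj I (\sum_(m <- s) (c m)%:MP * 'X_[m]) =
  \sum_(m <- s) (c m)%:MP *: quotient_proj I 'X_[m].
Proof.
rewrite (big_morph _ quotient_projD (id1 := 0)); last first.
  by apply/eqP; rewrite quotient_proj_eq0 rpred0.
by apply: eq_bigr => m _; rewrite /quotient_proj rmorphM.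
Qed.

Lemma quotient_hilbert : hilbert_function (@quotient_grading K n I)
  (fun d => \sum_(A in F) iter #|A| (delay 0%N) (num_monos #|A|) d)%N.
Proof.
have p0 : quotient_proj I 0 = 0 by apply/eqP; rewrite quotient_proj_eq0 rpred0.
split=> d; last first.
  exists (fun=> 0); split=> [v|c _ [] //]; rewrite /quotient_grading /=.
  split=> [[p -> ->]|[c ->]]; first by exists [ffun=> 0]; rewrite big_ord0.
  by exists 0; rewrite // big_ord0 p0.
rewrite -count_monos_supports /count_monos -size_filter; set s := filter _ _.
have us : uniq s by rewrite filter_uniq // uniq_monos.
apply: (@has_dim_seq K n _ s _ _ (fun m => quotient_proj I 'X_[m]) us) => [v|c].
  split=> [[p pd ->]|[c ->]].
    exists (fun m => p@_m); rewrite -quotient_proj_sum.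
    rewrite {1}(homog_sum_monos pd) !quotient_proj_sum big_filter.
    rewrite [RHS]big_mkcond /=; apply: eq_bigr => m _; case: ifP => // mF.
    have /eqP -> : quotient_proj I 'X_[m] == 0.
      by rewrite quotient_proj_eq0 monomial_in_ideal mF.
    by rewrite scaler0.
  exists (\sum_(m <- s) (c m)%:MP * 'X_[m]); last by rewrite quotient_proj_sum.
  by rewrite big_filter; exact: sum_monos_homog.
rewrite -quotient_proj_sum => /eqP; rewrite quotient_proj_eq0 => /FI.2 H m ms.
have := mcoeff_sum_monos c m us; rewrite ms => <-.
apply/eqP; rewrite mcoeff_eq0; apply/negP => /H.
by move: ms; rewrite mem_filter => /andP[->].
Qed.

End Complex.
End MonomialIdeal.

(** * Modules with a prescribed Hilbert function *)

Section Products.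
Variables (K : fieldType) (n : nat).
Local Notation S := {mpoly K[n]}.

Definition spans (M : lmodType S) (gs : seq M) (v : M) : Prop :=
  exists c : 'I_(size gs) -> S, v = \sum_(i < size gs) c i *: gs`_i.

Lemma spans_map (M N : lmodType S) (f : M -> N) gs v :
  (forall k (c : 'I_k -> S) (w : 'I_k -> M),
     f (\sum_(i < k) c i *: w i) = \sum_(i < k) c i *: f (w i)) ->
  spans gs v -> spans (map f gs) (f v).
Proof.
move=> fS [c ->]; rewrite /spans size_map fS; exists c.
by apply: eq_bigr => i _; rewrite (nth_map 0).
Qed.

Lemma spans_cat (M : lmodType S) (gs hs : seq M) u v :
  spans gs u -> spans hs v -> spans (gs ++ hs) (u + v).
Proof.
move=> [c ->] [e ->]; rewrite /spans size_cat.
exists (fun i => match split i with inl j => c j | inr j => e j end).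
rewrite big_split_ord /=; congr (_ + _); apply: eq_bigr => i _.
  by rewrite (unsplitK (inl i)) nth_cat /= ltn_ord.
by rewrite (unsplitK (inr i)) nth_cat /= ltnNge leq_addr /= addKn.
Qed.

Variables (M N : lmodType S) (grM : int -> M -> Prop) (grN : int -> N -> Prop).
Local Notation MN := (M * N)%type.

Definition prod_grading d (v : MN) : Prop := grM d v.1 /\ grN d v.2.

Lemma sum_pair (I : Type) (s : seq I) (F : I -> MN) :
  \sum_(i <- s) F i = (\sum_(i <- s) (F i).1, \sum_(i <- s) (F i).2).
Proof. by elim: s => [|i s IH]; rewrite ?big_nil // !big_cons IH. Qed.

Lemma prod_is_grading : is_grading grM -> is_grading grN ->
  is_grading prod_grading.
Proof.
move=> gM gN; split.
- by move=> d; split; exact: grading0.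
- by move=> d u v [? ?] [? ?]; split; exact: gradingB.
- by move=> d e p v pe [? ?]; split; exact: gradingZ.
- move=> [u v].
  have [f [grf [ds [uds f0 ->]]]] := decomposes_ex gM u.
  have [g [grg [es [ues g0 ->]]]] := decomposes_ex gN v.
  exists (undup (ds ++ es)), (fun d => (f d, g d)); split=> [d|]; first by split.
  by rewrite sum_pair; congr pair; apply/esym/sum_supportW;
     rewrite ?undup_uniq // => a; rewrite mem_undup mem_cat => ->; rewrite ?orbT.
- move=> ds f uds grf; rewrite sum_pair => -[s1 s2] d dds.
  rewrite [f d]surjective_pairing.
  rewrite (grading_direct gM uds (fun d => (grf d).1) s1 dds).
  by rewrite (grading_direct gN uds (fun d => (grf d).2) s2 dds).
Qed.

Lemma prod_fg : finitely_generated M -> finitely_generated N ->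
  finitely_generated MN.
Proof.
move=> [gs Hg] [hs Hh].
pose f (u : M) : MN := (u, 0); pose g (v : N) : MN := (0, v).
exists (map f gs ++ map g hs) => -[u v].
have -> : (u, v) = f u + g v :> MN by congr pair; rewrite /= ?addr0 ?add0r.
apply: spans_cat; apply: spans_map; [move=> k c w | exact: Hg | move=> k c w |
  exact: Hh].
  by rewrite sum_pair /= [X in (_, X)]big1 // => i _; rewrite scaler0.
by rewrite sum_pair /= [X in (X, _)]big1 // => i _; rewrite scaler0.
Qed.

Lemma prod_has_dim V W k l : @has_dim K n M V k -> @has_dim K n N W l ->
  has_dim (fun v : MN => V v.1 /\ W v.2) (k + l).
Proof.
move=> [e [eV fe]] [e' [eW fe']].
exists (fun i => match split i with inl j => (e j, 0) | inr j => (0, e' j) end).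
have E (c : {ffun 'I_(k + l) -> K}) :
    \sum_(i < k + l) (c i)%:MP *: match split i with inl j =>
      (e j, 0) | inr j => (0, e' j) end
    = (\sum_(i < k) (c (lshift l i))%:MP *: e i, \sum_(i < l) (c (rshift k
      i))%:MP *: e' i) :> MN.
  rewrite big_split_ord /= !sum_pair /=.
  under eq_bigr do rewrite (unsplitK (inl _)) /=.
  rewrite [X in (_, X)]big1 => [|i _]; last by rewrite (unsplitK (inl _)) /=
    scaler0.
  rewrite [X in _ + (X, _)]big1 => [|i _]; last by rewrite (unsplitK (inr _))
    /= scaler0.
  under [X in _ + (_, X)]eq_bigr do rewrite (unsplitK (inr _)) /=.
  by congr pair; rewrite /= ?addr0 ?add0r.
split=> [[u v] /=|c]; last first.
  rewrite E => -[E1 E2] i; rewrite -(splitK i); case: (split i) => j /=.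
    by have := fe [ffun i => c (lshift l i)]; 
       under eq_bigr do rewrite ffunE; move=> /(_ E1 j); rewrite ffunE.
  by have := fe' [ffun i => c (rshift k i)]; 
     under eq_bigr do rewrite ffunE; move=> /(_ E2 j); rewrite ffunE.
split=> [[/eV[a ->] /eW[b ->]]|[c]].
  exists [ffun i => match split i with inl j => a j | inr j => b j end].
  rewrite E; congr pair; apply: eq_bigr => i _; rewrite ffunE.
    by rewrite (unsplitK (inl _)).
  by rewrite (unsplitK (inr _)).
rewrite E => -[-> ->]; split.
  by apply/eV; exists [ffun i => c (lshift l i)]; apply: eq_bigr => i _;
    rewrite ffunE.
by apply/eW; exists [ffun i => c (rshift k i)]; apply: eq_bigr => i _;
  rewrite ffunE.
Qed.

Lemma in_ideal_mul_prod xs (v : MN) :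
  in_ideal_mul xs v <-> in_ideal_mul xs v.1 /\ in_ideal_mul xs v.2.
Proof.
split=> [[w ->]|[[a ea] [b eb]]].
  rewrite sum_pair; split; first by exists (fun i => (w i).1).
  by exists (fun i => (w i).2).
exists (fun i => (a i, b i)); rewrite sum_pair /=.
by rewrite [v]surjective_pairing ea eb.
Qed.

Lemma prod_weakly_regular xs :
  weakly_regular M xs -> weakly_regular N xs -> weakly_regular MN xs.
Proof.
move=> rM rN i ilt v /in_ideal_mul_prod[v1 v2]; apply/in_ideal_mul_prod.
by split; [exact: rM | exact: rN].
Qed.

End Products.

Section Realizable.
Variables (K : fieldType) (n D : nat).
Local Notation S := {mpoly K[n]}.

Lemma realizableD H1 H2 : realizable K n D H1 -> realizable K n D H2 ->
  realizable K n D (fun d => H1 d + H2 d)%N.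
Proof.
move=> [M [grM [gM fgM [Mp Mn] rM]]] [N [grN [gN fgN [Np Nn] rN]]].
exists (M * N)%type, (prod_grading grM grN); split.
- exact: prod_is_grading.
- exact: prod_fg.
- split=> d; first exact: prod_has_dim.
  exact: (prod_has_dim (Mn d) (Nn d)).
- exact: prod_weakly_regular.
Qed.

Lemma realizable0 : realizable K n D (fun=> 0%N).
Proof.
have z0 (v : 'M[S]_(1, 0)) : v = 0 by apply/matrixP => i [].
have dim0 (V : 'M[S]_(1, 0) -> Prop) : V 0 -> has_dim V 0.
  exists (fun=> 0); split=> [v|c _ []//]; rewrite (z0 v); split=> // _.
  by exists [ffun=> 0]; rewrite big_ord0.
exists 'M[S]_(1, 0), (fun _ _ => True); split.
- split=> //; first by move=> v; exists [::], (fun=> 0); rewrite (z0 v) big_nil.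
- exists [::] => v; exists (fun=> 0); rewrite (z0 v) big_ord0 //.
- by split=> d; exact: dim0.
- by move=> i _ v _; rewrite (z0 v); exact: in_ideal_mul0.
Qed.

Lemma eq_realizable H1 H2 : H1 =1 H2 -> realizable K n D H1 ->
  realizable K n D H2.
Proof.
move=> E [N [gr [gN fg [Hp Hn] wr]]]; exists N, gr; split=> //; split=> // d.
by rewrite -E.
Qed.

Lemma realizable_sum (I : Type) (s : seq I) (P : pred I) (H : I -> nat -> nat) :
  (forall i, P i -> realizable K n D (H i)) ->
  realizable K n D (fun d => \sum_(i <- s | P i) H i d)%N.
Proof.
move=> HI; elim: s => [|i s IH].
  by apply: eq_realizable realizable0 => d; rewrite big_nil.
have [Pi|nPi] := boolP (P i).
  apply: eq_realizable (realizableD (HI i Pi) IH) => d.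
  by rewrite big_cons Pi.
by apply: eq_realizable IH => d; rewrite big_cons (negPf nPi).
Qed.

End Realizable.

(** The quotient of K[x_0, ..., x_(n-1)] by the variables of index at least j,
    presented as the polynomial ring in j variables; n is a parameter because
    it determines the ring of scalars. *)
Definition cyclic_module (K : fieldType) (n j : nat) : Type := {mpoly K[j]}.
HB.instance Definition _ K n j := GRing.Zmodule.on (cyclic_module K n j).

Section Cyclic.
Variables (K : fieldType) (n j : nat).
Hypothesis jn : (j <= n)%N.
Local Notation S := {mpoly K[n]}.
Local Notation T := {mpoly K[j]}.

Local Notation cyclic := (cyclic_module K n j).

Definition restr : {rmorphism S -> T} :=
  mmap (@mpolyC j K) (fun i : 'I_n => mvar K j i).

Lemma restrE p :
  restr p = mmap (@mpolyC j K) (fun i : 'I_n => mvar K j i) p.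
Proof. by []. Qed.

Definition cyclic_scale (a : S) (u : cyclic) : cyclic := restr a * (u : T).

Fact cyclic_scaleA a b u : cyclic_scale a (cyclic_scale b u)
  = cyclic_scale (a * b) u.
Proof. by rewrite /cyclic_scale rmorphM mulrA. Qed.
Fact cyclic_scale1 : left_id 1 cyclic_scale.
Proof. by move=> u; rewrite /cyclic_scale rmorph1 mul1r. Qed.
Fact cyclic_scaleDr : right_distributive cyclic_scale +%R.
Proof. by move=> a u v; rewrite /cyclic_scale mulrDr. Qed.
Fact cyclic_scaleDl u : {morph cyclic_scale^~ u : a b / a + b}.
Proof. by move=> a b; rewrite /cyclic_scale rmorphD mulrDl. Qed.
HB.instance Definition _ := GRing.Zmodule_isLmodule.Build S cyclic
  cyclic_scaleA cyclic_scale1 cyclic_scaleDr cyclic_scaleDl.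

Lemma cyclicZ (a : S) (u : cyclic) : a *: u = (restr a * (u : T)) :> T.
Proof. by []. Qed.

Lemma restrC c : restr c%:MP = c%:MP.
Proof. exact: mmapC. Qed.

Lemma restr_var i : restr (mvar K n i) = mvar K j i.
Proof.
rewrite {1}/mvar; case: insubP => [k _ <-|].
  by rewrite restrE mmapX mmap1U.
rewrite -leqNgt => ni; rewrite rmorph0 /mvar insubF //.
by apply/negbTE; rewrite -leqNgt (leq_trans jn).
Qed.

Lemma restr_homog e p : p \is e.-homog -> restr p \is e.-homog.
Proof.
move=> /dhomogP pe; rewrite restrE /mmap big_seq; apply: rpred_sum => m /pe me.
rewrite mul_mpolyC dhomogZ //.
have <- : (\sum_(i < n) m i)%N = e by rewrite -mdegE.
rewrite /mmap1.
elim/big_rec2: _ => [|i d q _ qd]; first exact: dhomog1.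
by rewrite -[X in (X + _)%N]mul1n; apply: dhomogM => //;
  apply: dhomogMn; exact: mvar_homog.
Qed.

(** The generator has degree a. *)
Definition cyclic_grading (a : nat) (d : int) (p : cyclic) : Prop :=
  @poly_grading K j (d - a%:Z) p.

Lemma cyclic_is_grading a : is_grading (cyclic_grading a).
Proof.
rewrite /cyclic_grading; split.
- by move=> d; case: (d - _) => e //=; exact: dhomog0.
- move=> d u v; case: (d - _) => e /=; first exact: rpredB.
  by move=> -> ->; rewrite subr0.
- move=> d e p v pe; rewrite cyclicZ; have -> : d + e%:Z - a%:Z
  = d - a%:Z + e%:Z by lia.
  case: (d - _) => f /=; last by move=> ->; rewrite mulr0; case: (_ + _) =>
    //= *; exact: dhomog0.
  by rewrite addnC => vf; apply: dhomogM => //; exact: restr_homog.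
- move=> v; pose N := msize v.
  exists [seq (k + a)%:Z | k <- iota 0 N],
    (fun d => if d - a%:Z is Posz k then pihomog [measure of mdeg] k v else 0).
  split=> [d|]; first by case: (d - _) => //= k; exact: pihomogP.
  rewrite big_map; transitivity (\sum_(k < N) pihomog [measure of mdeg] k v).
    exact: pihomog_partitionE.
  rewrite -(big_mkord predT (fun k => pihomog [measure of mdeg] k v))
    /index_iota subn0.
  by apply: eq_bigr => k _; rewrite PoszD addrK.
- move=> ds f uds fd s0 d dds.
  move: (fd d); case E: (d - a%:Z) => [k|k] //= fk.
  have <- : pihomog [measure of mdeg] k (\sum_(e <- ds) (f e : T)) = f d;
    last first.
    by rewrite [X in pihomog _ _ X]s0 pihomog0.
  rewrite raddf_sum (bigD1_seq d) //= pihomog_dE // big1 ?addr0 // => e ed.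
  move: (fd e); case E' : (e - a%:Z) => [l|l] /= fe; last by rewrite fe pihomog0.
  rewrite (pihomog_ne0 _ fe) //; apply: contra_neq ed => link; lia.
Qed.

Lemma restr_surj (p : T) : exists q, restr q = p.
Proof.
pose q := \sum_(m <- msupp p) (p@_m)%:MP * \prod_(i < j) mvar K n i ^+ m i.
exists q; rewrite raddf_sum [RHS]mpolyE /=; apply: eq_bigr => m _.
rewrite rmorphM /= restrC rmorph_prod -mul_mpolyC mpolyXE_id; congr (_ * _).
by apply: eq_bigr => i _; rewrite rmorphXn /= restr_var mvarE.
Qed.

Lemma cyclic_fg : finitely_generated cyclic.
Proof.
exists [:: (1 : T) : cyclic] => v; have [q qv] := restr_surj v.
by exists (fun=> q); rewrite big_ord1 /= cyclicZ mulr1 qv.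
Qed.

Lemma cyclic_has_dim (V : T -> Prop) k : @has_dim K j T^o V k ->
  @has_dim K n cyclic V k.
Proof.
move=> [e [eV free]]; exists e.
have E (c : {ffun 'I_k -> K}) : \sum_(i < k) (c i)%:MP *: (e i : cyclic) =
    \sum_(i < k) (c i)%:MP *: (e i : T^o).
  by apply: eq_bigr => i _; rewrite cyclicZ restrC.
split=> [v|c]; last by rewrite E; exact: free.
by rewrite (eV v); split=> -[c ->]; exists c; rewrite E.
Qed.

Lemma cyclic_hilbert a :
  hilbert_function (cyclic_grading a) (iter a (delay 0%N) (num_monos j)).
Proof.
have [Hp Hn] := poly_grading_hilbert K j.
split=> d; apply: cyclic_has_dim; rewrite /cyclic_grading.
  rewrite iter_delayE; case: leqP => ad.
    by have -> : d%:Z - a%:Z = (d - a)%N by lia.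
  by have -> : d%:Z - a%:Z = Negz (a - d).-1 by lia.
by have -> : Negz d - a%:Z = Negz (d + a) by lia.
Qed.

Lemma in_ideal_mul_cyclic i (p : T) :
  in_ideal_mul (mkseq (mvar K n) i) (p : cyclic) <->
  in_ideal_mul (mkseq (mvar K j) i) (p : T^o).
Proof.
rewrite !in_ideal_mulP !size_mkseq.
have E (w : nat -> T) : \sum_(k < i) (mkseq (mvar K n) i)`_k *: (w k : cyclic) =
    \sum_(k < i) (mkseq (mvar K j) i)`_k *: (w k : T^o).
  by apply: eq_bigr => k _; rewrite !nth_mkseq // cyclicZ restr_var.
by split=> -[w ->]; exists w; rewrite E.
Qed.

(** Together with [in_ideal_mul_vars], this describes the ideal generated by the
    first i variables as the span of the monomials that involve one of them. *)
Lemma in_vars_msupp i (p : T) m : in_ideal_mul (mkseq (mvar K j) i) (p : T^o) ->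
  m \in msupp p -> exists2 k : 'I_j, (k < i)%N & m k != 0%N.
Proof.
move=> /in_ideal_mulP[w ->]; rewrite size_mkseq.
move=> /msupp_sum_le /flattenP[s /mapP[k _ ->]].
rewrite nth_mkseq // /mvar; case: insubP => [l _ link|_]; last first.
  by rewrite scale0r msupp0.
rewrite -[_ *: _]/('X_l * (w k : T)) mulrC => /msupp_mulX lm.
exists l; first by rewrite link.
by rewrite -lep1mP.
Qed.

Lemma cyclic_weakly_regular D : (D <= j)%N ->
  weakly_regular cyclic (mkseq (mvar K n) D).
Proof.
move=> Dj i; rewrite size_mkseq => iD v.
have -> : take i (mkseq (mvar K n) D) = mkseq (mvar K n) i.
  by rewrite -map_take take_iota (minn_idPl (ltnW iD)).
rewrite nth_mkseq //.
rewrite !in_ideal_mul_cyclic cyclicZ restr_var => vX.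
apply: in_ideal_mul_vars; first by apply: leq_trans Dj; exact: ltnW.
move=> m mv; have ij := leq_trans iD Dj.
have [|k ki mk] := in_vars_msupp (m := (m + U_(Ordinal ij))%MM) vX.
  rewrite mulrC (_ : mvar K j i = 'X_(Ordinal ij)) ?mcoeff_msupp; last first.
    by rewrite -mvarE.
  by rewrite addmC mcoeffMX -mcoeff_msupp.
exists k => //; move: mk; rewrite mnmDE mnm1E -val_eqE /=.
by rewrite (gtn_eqF ki) addn0.
Qed.

Lemma realizable_cyclic D a : (D <= j)%N ->
  realizable K n D (iter a (delay 0%N) (num_monos j)).
Proof.
move=> Dj; exists cyclic, (cyclic_grading a); split.
- exact: cyclic_is_grading.
- exact: cyclic_fg.
- exact: cyclic_hilbert.
- exact: cyclic_weakly_regular.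
Qed.

End Cyclic.

(** * Face numbers of simplicial complexes *)

Section FaceNumbers.
Variable T : finType.
Implicit Types (F : {set {set T}}) (V A B : {set T}) (v : T).

Definition fnum F k := #|[set A : {set T} in F | #|A| == k]|.

Definition is_complex F := forall A B, A \subset B -> B \in F -> A \in F.
Definition on_ground V F := forall A, A \in F -> A \subset V.

Definition deletion F v := [set A : {set T} in F | v \notin A].
Definition link F v := [set A : {set T} | (v \notin A) && (v |: A \in F)].

Lemma deletion_complex F v : is_complex F -> is_complex (deletion F v).
Proof.
move=> cF A B AB; rewrite !inE => /andP[BF vB].
by rewrite (cF _ _ AB BF); apply: contra vB; apply: (subsetP AB).
Qed.

Lemma link_complex F v : is_complex F -> is_complex (link F v).
Proof.
move=> cF A B AB; rewrite !inE => /andP[vB BF]; apply/andP; split.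
  by apply: contra vB; apply: (subsetP AB).
by apply: cF BF; exact: setUS.
Qed.

Lemma deletion_ground V F v : on_ground V F -> on_ground (V :\ v) (deletion F v).
Proof. by move=> VF A; rewrite inE => /andP[/VF AV vA]; rewrite subsetD1 AV. Qed.

Lemma link_ground V F v : on_ground V F -> on_ground (V :\ v) (link F v).
Proof.
move=> VF A; rewrite inE => /andP[vA /VF AV]; rewrite subsetD1 vA andbT.
exact: subset_trans (subsetU1 _ _) AV.
Qed.

Lemma fnum_link F v k : fnum (link F v) k = #|[set A :
  {set T} in F | (#|A| == k.+1) && (v \in A)]|.
Proof.
rewrite /fnum -(card_in_imset (f := fun A : {set T} => v |: A)).
  apply: eq_card => A; apply/imsetP/idP => [[B]|].
    rewrite !inE => /andP[/andP[vB BF] /eqP Bk] ->.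
    by rewrite BF cardsU1 vB Bk setU11 /= add1n eqxx.
  rewrite !inE => /andP[AF /andP[/eqP Ak vA]]; exists (A :\ v);
    last by rewrite setD1K.
  rewrite !inE eqxx setD1K // AF /=.
  by move: Ak; rewrite (cardsD1 v A) vA add1n => -[->].
move=> A B; rewrite !inE => /andP[/andP[vA _] _] /andP[/andP[vB _] _] E.
by rewrite -(setU1K vA) -(setU1K vB) E.
Qed.

Lemma fnum_deletion_link F v k : fnum F k.+1 = (fnum (deletion F v) k.+1 + fnum
  (link F v) k)%N.
Proof.
rewrite fnum_link /fnum -(cardsID [set A : {set T} | v \notin A]);
  congr (_ + _)%N.
  by apply: eq_card => A; rewrite !inE -!andbA andbC -andbA andbC -andbA;
    do !bool_congr.
by apply: eq_card => A; rewrite !inE negbK andbC -andbA.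
Qed.

(** Counts the pairs of a face of size k+1 and one of its vertices. *)
Lemma sum_fnum_link V F k : on_ground V F ->
  (\sum_(v in V) fnum (link F v) k = k.+1 * fnum F k.+1)%N.
Proof.
move=> VF; under eq_bigr do rewrite fnum_link -sum1dep_card.
rewrite (exchange_big_dep (fun A : {set T} =>
  (A \in F) && (#|A| == k.+1))) /=; last first.
  by move=> v A _ /and3P[-> ->].
rewrite /fnum mulnC -sum_nat_const; apply: eq_big => A; first by rewrite !inE.
move=> /andP[AF /eqP Ak]; rewrite -Ak -sum1_card; apply: eq_bigl => v.
by rewrite AF ?Ak eqxx /= andb_idl // => /(subsetP (VF _ AF)).
Qed.

Lemma fnum_le_ground V F k : on_ground V F -> (fnum F k <= 'C(#|V|, k))%N.
Proof.
move=> VF; rewrite -cards_draws; apply: subset_leq_card.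
by apply/subsetP => A; rewrite !inE => /andP[/VF -> ->].
Qed.

(** Removing a vertex from a face of size k+1 leaves a face of size k, and each
    face of size k arises at most once for every vertex outside of it. *)
Lemma fnum_shadow V F k : is_complex F -> on_ground V F ->
  (k.+1 * fnum F k.+1 <= (#|V| - k) * fnum F k)%N.
Proof.
move=> cF VF; rewrite -(sum_fnum_link _ VF).
have le v : v \in V -> (fnum (link F v) k <= #|[set A :
  {set T} in F | (#|A| == k) && (v \notin A)]|)%N.
  move=> _; apply: subset_leq_card; apply/subsetP => A; rewrite !inE.
  case/andP=> /andP[vA BF] ->; rewrite vA (cF _ _ _ BF) //; exact: subsetU1.
apply: (@leq_trans (\sum_(v in V) #|[set A : {set T} in F | (#|A| == k) && (v
  \notin A)]|)%N).
  exact: leq_sum.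
under eq_bigr do rewrite -sum1dep_card.
rewrite (exchange_big_dep (fun A : {set T} => (A \in F) && (#|A| == k))) /=;
  last first.
  by move=> v A _ /and3P[-> ->].
rewrite [leqRHS]mulnC /fnum -sum_nat_const.
rewrite [leqRHS](eq_bigl (fun A : {set T} => (A \in F) && (#|A| == k)));
  last first.
  by move=> A; rewrite inE.
apply: leq_sum => A /andP[AF /eqP Ak].
have -> : (#|V| - k)%N = #|V :\: A| by rewrite cardsD (setIidPr (VF _ AF)) Ak.
rewrite sum1dep_card; apply/eq_leq/eq_card => v.
by rewrite !inE AF Ak eqxx andbC.
Qed.

Lemma vertex_ground F : is_complex F ->
  exists2 V, on_ground V F & #|V| = fnum F 1.
Proof.
move=> cF; pose V := [set v | [set v] \in F].
have VF : on_ground V F.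
  by move=> A AF; apply/subsetP => v vA; rewrite inE (cF _ _ _ AF) // sub1set.
exists V => //; rewrite /fnum -[LHS](card_imset _ set1_inj); apply: eq_card => A.
rewrite !inE; apply/imsetP/andP => [[v]|[AF /cards1P[v E]]].
  by rewrite inE => vF ->; rewrite cards1.
by exists v; rewrite // inE -E.
Qed.

Lemma fnum_le F k : is_complex F -> (fnum F k <= 'C(fnum F 1, k))%N.
Proof. by move=> cF; have [V VF <-] := vertex_ground cF;
  exact: fnum_le_ground. Qed.

(** Bounds the number of faces of size k+1 of a complex on a vertices with e
    faces of size k.  A vertex contained in d of these splits the complex into
    its deletion, with e - d faces of size k, and its link, with d faces of size
    k-1; for a vertex of least degree, a d <= k e.  The maximum is taken over all
    values of d that satisfy this and the trivial bounds. *)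
Fixpoint shadow_bound (a k e : nat) : nat :=
  match k with
  | 0 => 0
  | 1 => 'C(e, 2)
  | k'.+1 => if a is a'.+1 then
      foldr maxn 0 [seq shadow_bound a' k (e - d) + shadow_bound a' k' d
        | d <- iota 0 e.+1 & [&& a * d <= k * e, d <= 'C(a', k') & e - d
          <= 'C(a', k)]]
      else 0
  end%N.

Lemma leq_foldr_maxn x (s : seq nat) : x \in s -> (x <= foldr maxn 0 s)%N.
Proof.
elim: s => //= y s IH; rewrite inE => /predU1P[->|/IH le];
  rewrite leq_max ?leqnn //.
by rewrite le orbT.
Qed.

Lemma fnum_shadow_bound V F k : is_complex F -> on_ground V F ->
  (fnum F k.+2 <= shadow_bound #|V| k.+1 (fnum F k.+1))%N.
Proof.
move Ea: #|V| => a; elim: a k V F Ea => [|a IH] k V F Va cF VF.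
  by apply: leq_trans (fnum_le_ground _ VF) _; rewrite Va.
case: k => [|k]; first exact: fnum_le.
have /card_gt0P[v0 v0V] : (0 < #|V|)%N by rewrite Va.
case: (arg_minnP (fun v => fnum (link F v) k.+1) v0V) => v vmem vmin.
have vV : v \in V := vmem.
have Vv : #|V :\ v| = a by move: (cardsD1 v V); rewrite vV Va => -[].
have cd := deletion_complex (v := v) cF; have cl := link_complex (v := v) cF.
have gd := deletion_ground (v := v) VF; have gl := link_ground (v := v) VF.
rewrite (fnum_deletion_link F v k.+2) [X in shadow_bound _ _
  X](fnum_deletion_link F v k.+1).
apply: leq_trans (leq_add (IH k.+1 _ _ Vv cd gd) (IH k _ _ Vv cl gl)) _.
apply: leq_foldr_maxn; apply/mapP; exists (fnum (link F v) k.+1);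
  last by rewrite addnK.
rewrite mem_filter mem_iota leq0n add0n ltnS leq_addl andbT addnK.
rewrite andbT; apply/and3P; split; first last.
- by rewrite -Vv; exact: fnum_le_ground.
- by rewrite -Vv; exact: fnum_le_ground.
rewrite -fnum_deletion_link -(sum_fnum_link _ VF) -Va -sum_nat_const.
by apply: leq_sum => w; exact: vmin.
Qed.

End FaceNumbers.

Section FaceInequalities.
Local Open Scope nat_scope.

(** The three inequalities below for the numbers of vertices that are too small
    for double counting, checked on all face numbers that the hypotheses allow. *)
Lemma shadow_table2 : all (fun a => all (fun e => (a <= e.+1) ==>
    (shadow_bound a 2 e + a <= 'C(a.-1, 3) + e + 1)) (iota 0 'C(a, 2).+1))
  (iota 2 3).
Proof. by vm_compute. Qed.

Lemma shadow_table3 : all (fun a => all (fun e => (a.*2 <= e + 3) ==>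
    (shadow_bound a 2 e + 3 * a <= 'C(a.-2, 3) + 2 * e + 4))
  (iota 0 'C(a, 2).+1)) (iota 3 5).
Proof. by vm_compute. Qed.

Lemma shadow_table4 : all (fun a => all (fun e => all (fun t => (e + 1
  <= t + a) ==>
    (shadow_bound a 3 t + e + 1 <= 'C(a.-1, 4) + t + a)) (iota 0 'C(a, 3).+1))
   (iota (a.*2 - 3) ('C(a, 2).+1 - (a.*2 - 3)))) (iota 3 4).
Proof. by vm_compute. Qed.

(** In [face_ineq2], e and t are the numbers of edges and triangles, and P, Q the
    binomial coefficients for a = b + 5 vertices.  The double count, which is the
    first hypothesis, reduces the conclusion to b e <= b P, with equality
    everywhere for the full simplex.  The next two lemmas are similar. *)
Lemma face_arith2 b t e P Q : 3 * t <= (b + 3) * e -> e <= P ->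
  2 * P = (b + 5) * (b + 4) -> 6 * Q = (b + 4) * ((b + 3) * (b + 2)) ->
  t + (b + 5) <= Q + e + 1.
Proof.
move=> H1 H2 H3 H4; have H : b * e <= b * P by rewrite leq_mul2l H2 orbT.
have H' : b * (2 * P) = b * ((b + 5) * (b + 4)) by rewrite H3.
nia.
Qed.

Lemma face_arith3 b t e P Q : 3 * t <= (b + 6) * e -> e <= P ->
  2 * P = (b + 8) * (b + 7) -> 6 * Q = (b + 6) * ((b + 5) * (b + 4)) ->
  t + 3 * (b + 8) <= Q + 2 * e + 4.
Proof.
move=> H1 H2 H3 H4; have H : b * e <= b * P by rewrite leq_mul2l H2 orbT.
have H' : b * (2 * P) = b * ((b + 8) * (b + 7)) by rewrite H3.
nia.
Qed.

Lemma face_arith4 b q t e P R Q : 4 * q <= (b + 4) * t -> t <= R -> e <= P ->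
  2 * P = (b + 7) * (b + 6) -> 6 * R = (b + 7) * ((b + 6) * (b + 5)) ->
  24 * Q = (b + 6) * ((b + 5) * ((b + 4) * (b + 3))) ->
  q + e + 1 <= Q + t + (b + 7).
Proof.
move=> H1 H2 H2' H3 H4 H5; have H : b * t <= b * R by rewrite leq_mul2l H2 orbT.
have H' : b * (6 * R) = b * ((b + 7) * ((b + 6) * (b + 5))) by rewrite H4.
nia.
Qed.

Variables (T : finType) (F : {set {set T}}).
Hypothesis cF : is_complex F.
Let a := fnum F 1.

Lemma fnum_shadow_vertices k : k.+1 * fnum F k.+1 <= (a - k) * fnum F k.
Proof. by have [V VF] := vertex_ground cF; rewrite /a => <-;
  exact: fnum_shadow. Qed.

Lemma fnum_shadow_bound_vertices k : fnum F k.+2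
  <= shadow_bound a k.+1 (fnum F k.+1).
Proof. by have [V VF] := vertex_ground cF; rewrite /a => <-;
  exact: fnum_shadow_bound. Qed.

Lemma bin_poly m : [/\ 2 * 'C(m.+1, 2) = m.+1 * m,
  6 * 'C(m.+2, 3) = m.+2 * (m.+1 * m) &
  24 * 'C(m.+3, 4) = m.+3 * (m.+2 * (m.+1 * m))].
Proof.
have E2 k : 2 * 'C(k.+1, 2) = k.+1 * k by rewrite -mul_bin_diag bin1.
have E3 k : 6 * 'C(k.+2, 3) = k.+2 * (k.+1 * k).
  by rewrite -E2 (mulnCA k.+2) mul_bin_diag mulnA.
split=> //; by rewrite -E3 (mulnCA m.+3) mul_bin_diag mulnA.
Qed.

(** In each of the next three inequalities, equality holds for the full simplex
    on a vertices. *)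
Lemma face_ineq2 : 2 <= a -> a <= fnum F 2 + 1 ->
  fnum F 3 + a <= 'C(a.-1, 3) + fnum F 2 + 1.
Proof.
move=> a2 ae; have eC : fnum F 2 <= 'C(a, 2) := fnum_le 2 cF.
have te := fnum_shadow_vertices 2.
have [a5|a5] := ltnP a 5.
  have /allP/(_ a) := shadow_table2; rewrite mem_iota a2 a5 => /(_ isT).
  move=> /allP/(_ (fnum F 2)); rewrite mem_iota /= ltnS eC => /(_ isT)/implyP.
  by move: (fnum_shadow_bound_vertices 1) => sb /(_ _); lia.
have [b ab] : exists b, a = b + 5 by exists (a - 5); lia.
have [E1 _ _] := bin_poly (b + 4); have [_ E2 _] := bin_poly (b + 2).
rewrite -!addnS -?ab in E1 E2; rewrite {2}ab in E1; rewrite (_ : a - 2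
  = b + 3) in te; last by lia.
rewrite (_ : a.-1 = b + 4) ?{1}ab; last by lia.
exact: face_arith2 te eC E1 E2.
Qed.

Lemma face_ineq3 : 3 <= a -> a.*2 <= fnum F 2 + 3 ->
  fnum F 3 + 3 * a <= 'C(a.-2, 3) + 2 * fnum F 2 + 4.
Proof.
move=> a3 ae; have eC : fnum F 2 <= 'C(a, 2) := fnum_le 2 cF.
have te := fnum_shadow_vertices 2.
have [a8|a8] := ltnP a 8.
  have /allP/(_ a) := shadow_table3; rewrite mem_iota a3 a8 => /(_ isT).
  move=> /allP/(_ (fnum F 2)); rewrite mem_iota /= ltnS eC => /(_ isT)/implyP.
  by move: (fnum_shadow_bound_vertices 1) => sb /(_ ae); lia.
have [b ab] : exists b, a = b + 8 by exists (a - 8); lia.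
have [E1 _ _] := bin_poly (b + 7); have [_ E2 _] := bin_poly (b + 4).
rewrite -!addnS -?ab in E1 E2; rewrite {2}ab in E1; rewrite (_ : a - 2
  = b + 6) in te; last by lia.
rewrite (_ : a.-2 = b + 6) ?{1}ab; last by lia.
exact: face_arith3 te eC E1 E2.
Qed.

Lemma face_ineq4 : 3 <= a -> a.*2 <= fnum F 2 + 3 -> fnum F 2 + 1
  <= fnum F 3 + a ->
  fnum F 4 + fnum F 2 + 1 <= 'C(a.-1, 4) + fnum F 3 + a.
Proof.
move=> a3 ae et; have eC : fnum F 2 <= 'C(a, 2) := fnum_le 2 cF.
have tC : fnum F 3 <= 'C(a, 3) := fnum_le 3 cF.
have qt := fnum_shadow_vertices 3.
have [a7|a7] := ltnP a 7.
  have /allP/(_ a) := shadow_table4; rewrite mem_iota a3 a7 => /(_ isT).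
  move=> /allP/(_ (fnum F 2)); rewrite mem_iota subnKC; last first.
    by move: (leq_trans ae (leq_add eC (leqnn 3))); lia.
  rewrite leq_subLR addnC ae ltnS eC => /(_ isT).
  move=> /allP/(_ (fnum F 3)); rewrite mem_iota /= ltnS tC => /(_ isT)/implyP.
  by move: (fnum_shadow_bound_vertices 2) => sb /(_ et); lia.
have [b ab] : exists b, a = b + 7 by exists (a - 7); lia.
have [E1 _ _] := bin_poly (b + 6); have [_ E2 _] := bin_poly (b + 5).
have [_ _ E3] := bin_poly (b + 3).
rewrite -!addnS -?ab in E1 E2 E3; rewrite {2}ab in E1; rewrite {2}ab in E2;
  rewrite (_ : a - 3 = b + 4) in qt; last by lia.
rewrite (_ : a.-1 = b + 6) ?{1}ab; last by lia.
exact: face_arith4 qt tC eC E1 E2 E3.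
Qed.

End FaceInequalities.

(** * Positivity of differences and realizability *)

Section Differences.
Implicit Types (f g : nat -> int) (q d : nat).

Lemma iter_diff_sum q (I : Type) (s : seq I) (P : pred I) (F : I -> nat ->
  int) d :
  iter q diff (fun d => \sum_(i <- s | P i) F i d) d =
  \sum_(i <- s | P i) iter q diff (F i) d.
Proof.
elim: q d => [//|q IH] [|d] /=; first exact: IH.
by rewrite !IH -sumrB.
Qed.

Lemma iter_diffD q f g d :
  iter q diff (fun d => f d + g d) d = iter q diff f d + iter q diff g d.
Proof.
elim: q d => [//|q IH] [|d] /=; first exact: IH.
by rewrite !IH opprD addrACA.
Qed.

Lemma iter_diffZ q c f d :
  iter q diff (fun d => c * f d) d = c * iter q diff f d.
Proof.
elim: q d => [//|q IH] [|d] /=; first exact: IH.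
by rewrite !IH mulrBr.
Qed.

Lemma iter_diff_inj q f g : iter q diff f =1 iter q diff g -> f =1 g.
Proof.
elim: q => [//|q IH] E; apply: IH; elim=> [|d IHd]; first exact: (E 0%N).
by have := E d.+1; rewrite /= IHd => /addIr.
Qed.

Lemma iter_diff_support q f m : (forall d, (m < d)%N -> f d = 0) ->
  forall d, (m + q < d)%N -> iter q diff f d = 0.
Proof.
move=> f0; elim: q => [|q IH] [|d] //=; rewrite ?addn0; first exact: f0.
rewrite addnS => lt; rewrite !IH ?subrr //; lia.
Qed.

(** The Hilbert function of a polynomial ring in j variables whose generator has
    degree k. *)
Definition hpoly k j d : nat := iter k (delay 0%N) (num_monos j) d.

Lemma hpolyE k j d : hpoly k j d = if (k <= d)%N then num_monos j (d - k) else
  0%N.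
Proof. exact: iter_delayE. Qed.

Lemma iter_diff_hpoly q k j d :
  iter q diff (fun d => (hpoly k (q + j) d)%:Z) d = (hpoly k j d)%:Z.
Proof.
elim: q d => [//|q IH] d; rewrite iterSr -IH; apply: eq_diff => {IH}d.
rewrite addSn; move: (q + j)%N => J.
case: d => [|d]; rewrite /= !hpolyE; first by case: k => [|k] //=;
  rewrite !num_monos0.
case: (ltngtP k d.+1) => [lt|gt|->].
- by rewrite ltnS in lt; rewrite lt (subSn lt) num_monosS; lia.
- by rewrite leqNgt (ltnW gt).
- by rewrite ltnn subnn !num_monos0.
Qed.

End Differences.

Section Realization.
Variables (K : fieldType) (n : nat).

(** Counts the monomials of degree d whose support belongs to G. *)
Definition hfaces (G : {set {set 'I_n}}) (d : nat) : nat :=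
  (\sum_(A in G) hpoly #|A| #|A| d)%N.

(** Let b_k be the D-th difference at k.  The supports with more than D elements
    contribute polynomial rings in more than D variables as they stand.  The
    others contribute functions whose D-th difference vanishes above degree D,
    and are replaced by b_k polynomial rings in D variables generated in degree
    k, for each k <= D: both sides then have the same D-th difference. *)
Lemma realizable_hfaces (G : {set {set 'I_n}}) D : (D <= n)%N ->
  (forall k, (k <= D)%N -> 0 <= iter D diff (fun d => (hfaces G d)%:Z) k) ->
  realizable K n D (hfaces G).
Proof.
move=> Dn pos; pose b k := iter D diff (fun d => (hfaces G d)%:Z) k.
pose low d := (\sum_(k < D.+1) `|b k| * hpoly k D d)%N.
pose high d := (\sum_(A in G | D < #|A|) hpoly #|A| #|A| d)%N.
apply: (@eq_realizable _ _ _ (fun d => low d + high d)%N); last first.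
  apply: realizableD; apply: realizable_sum; [move=> k _ | move=> A /andP[_
    DA]]; last first.
    by apply: realizable_cyclic; rewrite ?(ltnW DA) // -[leqRHS](card_ord n)
      max_card.
  apply: (@eq_realizable _ _ _ (fun d => \sum_(i < `|b k|) hpoly k D d)%N).
    by move=> d; rewrite sum_nat_const card_ord.
  by apply: realizable_sum => i _; exact: realizable_cyclic.
suff E : (fun d => (low d + high d)%N%:Z) =1 (fun d => (hfaces G d)%:Z).
  by move=> d; have [] := E d.
pose rest d := (\sum_(A in G | #|A| <= D) hpoly #|A| #|A| d)%N.
have split_faces d : hfaces G d = (rest d + high d)%N.
  rewrite /hfaces (bigID (fun A : {set 'I_n} => #|A| <= D)%N) /=; congr (_ + _)%N.
  by apply: eq_bigl => A; rewrite -ltnNge.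
have Dhigh d : (d <= D)%N -> iter D diff (fun d => (high d)%:Z) d = 0.
  move=> dD; have sumz := big_morph Posz PoszD (erefl _).
  rewrite (@eq_diff _ _ (fun d => \sum_(A in G | (D < #|A|)%N) (hpoly #|A| #|A|
    d)%:Z)) => [|e].
    rewrite iter_diff_sum big1 // => A /andP[_ DA].
    have := iter_diff_hpoly D #|A| (#|A| - D) d;
      rewrite subnKC ?(ltnW DA) // => ->.
    by rewrite hpolyE leqNgt (leq_ltn_trans dD DA).
  exact: sumz.
have Drest d : (D < d)%N -> iter D diff (fun d => (rest d)%:Z) d = 0.
  move=> dD; have sumz := big_morph Posz PoszD (erefl _).
  rewrite (@eq_diff _ _ (fun d => \sum_(A in G | (#|A|
    <= D)%N) (hpoly #|A| #|A| d)%:Z)) => [|e].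
    rewrite iter_diff_sum big1 // => A /andP[_ AD].
    rewrite -(subnK AD) iterD.
    rewrite (@eq_diff _ _ (fun d => (hpoly #|A| 0 d)%:Z)) => [|e]; last first.
      by have := iter_diff_hpoly #|A| #|A| 0 e; rewrite addn0.
    apply: (@iter_diff_support _ _ #|A|); last by rewrite subnKC.
    move=> e Ae; rewrite hpolyE ltnW // /=.
    by rewrite subn_eq0 leqNgt Ae.
  exact: sumz.
have Dlow d : iter D diff (fun d => (low d)%:Z) d = if (d <= D)%N then b d else 0.
  have sumz := big_morph Posz PoszD (erefl _).
  rewrite (@eq_diff _ _ (fun d => \sum_(k < D.+1) (`|b k|%N)%:Z * (hpoly k D
    d)%:Z)) => [|e]; last first.
    by rewrite /low [LHS]sumz; apply: eq_bigr => k _; rewrite PoszM.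
  rewrite iter_diff_sum.
  have term k : iter D diff (fun d => (`|b k|%N)%:Z * (hpoly k D d)%:Z) d =
      if k == d then (`|b k|%N)%:Z else 0.
    rewrite iter_diffZ; have := iter_diff_hpoly D k 0 d; rewrite addn0 => ->.
    rewrite hpolyE; case: (ltngtP k d) => [lt|gt|->] /=.
    - by rewrite subn_eq0 leqNgt lt mulr0.
    - by rewrite mulr0.
    - by rewrite subnn mulr1.
  under eq_bigr do rewrite term.
  rewrite -big_mkcond /=; case: leqP => dD.
    rewrite (big_pred1 (inord d)) => [|k]; first by rewrite inordK // gez0_abs
      // pos.
    by apply/eqP/eqP => [<-|->]; rewrite ?inord_val // inordK.
  by rewrite big1 // => k /eqP Ek; move: (ltn_ord k); rewrite Ek ltnS leqNgt dD.
apply: (@iter_diff_inj D) => d.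
rewrite (@eq_diff _ _ (fun d => (low d)%:Z + (high d)%:Z)) // iter_diffD Dlow.
case: leqP => dD; first by rewrite Dhigh // addr0.
rewrite [RHS](@eq_diff _ _ (fun d => (rest d)%:Z + (high d)%:Z)) => [|e];
  last first.
  by rewrite split_faces PoszD.
by rewrite iter_diffD Drest.
Qed.

End Realization.

(** * From faces to nonfaces *)

(** The Hilbert function h in degrees at most 4, in terms of the numbers f of
    supports of each size. *)
Definition low_hilbert (f h : nat -> nat) : Prop :=
  [/\ h 0 = f 0, h 1 = f 1, h 2 = f 1 + f 2, h 3 = f 1 + 2 * f 2 + f 3
   & h 4 = f 1 + 3 * f 2 + 3 * f 3 + f 4]%N.

Lemma bin2_gap a m q : (a <= m)%N -> (q <= a)%N ->
  (q * (m - a) + 'C(a, 2) <= 'C(m, 2))%N.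
Proof.
move=> am qa; rewrite -(subnK am) addnK; elim: (m - a)%N => [|t IH].
  by rewrite muln0.
by rewrite addSn binS bin1 mulnS; move: IH; lia.
Qed.

(** The part of the argument that involves only numbers, a and b being the
    numbers of faces and of nonfaces of each size.  Positivity for a gives
    a_q >= 1, so q <> n because a_n = 0.  In degrees 3 and 4, Pascal's rule turns
    positivity for b into the inequalities between face numbers, with n in
    place of the number of vertices; degree 2 is [bin2_gap]. *)
Lemma nonface_arith n q (a b h g : nat -> nat) :
  (forall j, a j + b j = 'C(n, j))%N -> a 0 = 1%N -> a n = 0%N ->
  (forall j, a j <= 'C(a 1, j))%N ->
  (2 <= a 1 -> a 1 <= a 2 + 1 -> a 3 + a 1 <= 'C((a 1).-1, 3) + a 2 + 1)%N ->
  (3 <= a 1 -> (a 1).*2 <= a 2 + 3 ->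
     a 3 + 3 * a 1 <= 'C((a 1).-2, 3) + 2 * a 2 + 4)%N ->
  (3 <= a 1 -> (a 1).*2 <= a 2 + 3 -> a 2 + 1 <= a 3 + a 1 ->
     a 4 + a 2 + 1 <= 'C((a 1).-1, 4) + a 3 + a 1)%N ->
  low_hilbert a h -> low_hilbert b g -> (q <= 3)%N ->
  (forall d, 0 <= iter q diff (fun d => (h d)%:Z) d) ->
  (q < n)%N /\ forall k, (k <= q.+1)%N ->
    0 <= iter q.+1 diff (fun d => (g d)%:Z) k.
Proof.
move=> C a0 an ea i2 i3 i4 [f0 f1 f2 f3 f4] [g0 g1 g2 g3 g4] q3 pos.
have C0 := C 0%N; have C1 := C 1%N; have C2 := C 2%N; have C3 := C 3%N;
  have C4 := C 4%N.
rewrite bin0 bin1 in C0 C1; rewrite a0 in C0.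
have e2 := ea 2%N; have e3 := ea 3%N; have e4 := ea 4%N.
have n0 : (0 < n)%N by case: posnP => // n0; move: an; rewrite n0 a0.
have a1n : (a 1 <= n)%N by lia.
have p1 := pos 1%N; have p2 := pos 2%N; have p3 := pos 3%N.
have nF j : n = j -> a j = 0%N by move=> <-.
have qn : (q < n)%N.
  rewrite ltnNge; apply/negP => nq.
  have := nF q; case: q q3 pos nq p1 p2 p3 => [|[|[|[|//]]]] _ _ nq /=;
  rewrite ?f0 ?f1 ?f2 ?f3 ?a0 => p1 p2 p3.
  - lia.
  - move=> H; have := H _; lia.
  - move=> H; have := H _; lia.
  - move=> H; have := H _; lia.
split=> // k kq.
have n1 k' : 'C(n, k'.+1) = ('C(n.-1, k'.+1) + 'C(n.-1, k'))%N.
  by rewrite -{1}(prednK n0) binS.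
have le2 : (q <= a 1)%N -> (q * b 1 <= b 2)%N.
  move=> qa; have := bin2_gap a1n qa; rewrite -C2 (_ : n - a 1 = b 1)%N.
    by move: e2; lia.
  by lia.
have mono x y k' : (x <= y)%N -> ('C(x, k') <= 'C(y, k'))%N by exact: leq_bin2l.
have m3 : ('C((a 1).-1, 3) <= 'C(n.-1, 3))%N by apply: mono; lia.
have m3' : ('C((a 1).-2, 3) <= 'C(n.-2, 3))%N by apply: mono; lia.
have m4 : ('C((a 1).-1, 4) <= 'C(n.-1, 4))%N by apply: mono; lia.
have P1 := n1 1%N; have P2 := n1 2%N; have P3 := n1 3%N; rewrite bin1 in P1.
clear n1 mono.
case: q q3 pos p1 p2 p3 le2 kq qn => [|[|[|[|//]]]] _ _ p1 p2 p3 le2;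
  move: p1 p2 p3; rewrite /= ?f0 ?f1 ?f2 ?f3 ?a0 => p1 p2 p3.
- by case: k => [|[|//]] _ _; rewrite /= ?g0 ?g1; lia.
- by case: k => [|[|[|//]]] _ _; rewrite /= ?g0 ?g1 ?g2; lia.
- have a12 : (2 <= a 1)%N by lia.
  have a21 : (a 1 <= a 2 + 1)%N by lia.
  have {i3 i4}j2 := i2 a12 a21; have {}le2 := le2 a12.
  case: k => [|[|[|[|//]]]] _ _; rewrite /= ?g0 ?g1 ?g2 ?g3; lia.
have a13 : (3 <= a 1)%N by lia.
have a23 : ((a 1).*2 <= a 2 + 3)%N by lia.
have a32 : (a 2 + 1 <= a 3 + a 1)%N by lia.
have {i2}j3 := i3 a13 a23; have j4 := i4 a13 a23 a32; have {}le2 := le2 a13.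
have n2 k' : (2 < n)%N -> 'C(n.-1, k'.+1) = ('C(n.-2, k'.+1) + 'C(n.-2, k'))%N.
  by move=> n2; rewrite -{1}(@prednK n.-1) ?binS //; lia.
have R1 := n2 1%N; have R2 := n2 2%N; rewrite bin1 in R1.
case: k => [|[|[|[|[|//]]]]] _ n3; rewrite /= ?g0 ?g1 ?g2 ?g3 ?g4;
  move: (R1 (ltnW n3)) (R2 (ltnW n3)); lia.
Qed.

Section Nonfaces.
Variables (n : nat) (F : {set {set 'I_n}}).
Hypotheses (cF : is_complex F) (F0 : set0 \in F) (FT : setT \notin F).

Lemma hfaces_fnum (G : {set {set 'I_n}}) d :
  hfaces G d = (\sum_(j < d.+1) fnum G j * num_monos j (d - j))%N.
Proof.
rewrite /hfaces (bigID (fun A : {set 'I_n} => #|A|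
  <= d)%N) /= addnC big1 ?add0n; last first.
  by move=> A /andP[_ /negPf dA]; rewrite hpolyE dA.
rewrite (partition_big (fun A : {set 'I_n} => inord #|A| : 'I_d.+1) predT) //=.
apply: eq_bigr => j _; rewrite /fnum -sum_nat_const.
apply: eq_big => A; last first.
  by move=> /andP[/andP[_ Ad] /eqP <-]; rewrite hpolyE Ad inordK.
rewrite inE -andbA; congr (_ && _); apply/andP/eqP => [[Ad /eqP <-]|Aj].
  by rewrite inordK.
by rewrite Aj inord_val eqxx -ltnS ltn_ord.
Qed.

Lemma fnumC j : (fnum F j + fnum (~: F) j = 'C(n, j))%N.
Proof.
have := cards_draws [set: 'I_n] j; rewrite cardsT card_ord => <-.
rewrite -(cardsID F); congr (_ + _)%N; apply: eq_card => A;
  rewrite !inE subsetT //=.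
by rewrite andbC.
Qed.

Lemma fnumF0 : fnum F 0 = 1%N.
Proof.
rewrite /fnum -(cards1 (set0 : {set 'I_n})); apply: eq_card => A;
  rewrite !inE cards_eq0.
by case: eqP => [->|]; rewrite ?F0 ?andbF.
Qed.

Lemma fnumFn : fnum F n = 0%N.
Proof.
apply/eqP; rewrite cards_eq0; apply/eqP/setP => A; rewrite !inE.
apply/andP => -[AF An]; move: FT; suff <- : A = setT by rewrite AF.
by apply/eqP; rewrite eqEcard subsetT cardsT card_ord (eqP An) leqnn.
Qed.

Lemma hfacesE (G : {set {set 'I_n}}) : low_hilbert (fnum G) (hfaces G).
Proof.
split; rewrite hfaces_fnum !big_ord_recr big_ord0 /= ?muln1 ?muln0 ?add0n //; lia.
Qed.

Lemma diff_nonfaces q : (q <= 3)%N ->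
  (forall d, 0 <= iter q diff (fun d => (hfaces F d)%:Z) d) ->
  (q < n)%N /\ forall k, (k <= q.+1)%N ->
    0 <= iter q.+1 diff (fun d => (hfaces (~: F) d)%:Z) k.
Proof.
apply: nonface_arith (hfacesE F) (hfacesE (~: F)).
- exact: fnumC.
- exact: fnumF0.
- exact: fnumFn.
- by move=> j; exact: fnum_le.
- exact: face_ineq2.
- exact: face_ineq3.
- exact: face_ineq4.
Qed.

End Nonfaces.

Theorem theorem3p9 (K : fieldType) (n : nat) (I : idealr {mpoly K[n]})
    (hI : squarefree_monomial_ideal I)
    (hI0 : exists2 p : {mpoly K[n]}, p \in I & p != 0)
    (hd : (hdepth (@quotient_grading K n I) <= 3)%N) :
  (hdepth (@ideal_grading K n I) >= hdepth (@quotient_grading K n I) + 1)%N.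
Proof.
have [F FI] := squarefree_stanley_reisner hI; have cF : is_complex F := FI.1.
have F0 : set0 \in F.
  have := monomial_in_ideal FI 0%MM; rewrite msuppset0 mpolyX0 idealr1.
  by move/esym/negbFE.
have FT : setT \notin F.
  have [p pI p0] := hI0; apply: contraL (mlead_supp p0) => TF.
  by apply/negP => /(FI.2 p).1 -/(_ pI); rewrite (cF _ _ (subsetT _) TF).
have HQ := quotient_hilbert FI; have HI := ideal_hilbert FI.
rewrite -/(hfaces F) in HQ.
have F00 : (0 < hfaces F 0)%N by rewrite (hfaces_fnum F 0) big_ord1 fnumF0.
have real0 (G : {set {set 'I_n}}) : realizable K n 0 (hfaces G).
  apply: (@realizable_hfaces K n G 0) => // k _.
have [//|pos _] := hdepthP HQ _ F00 (real0 F).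
have [qn posI] := diff_nonfaces cF F0 FT hd pos.
have [c Hc Hmin] : exists2 c, (0 < hfaces (~: F) c)%N &
    forall d, (d < c)%N -> hfaces (~: F) d = 0%N.
  have ex : exists c, (0 < hfaces (~: F) c)%N.
    exists n; rewrite /hfaces (bigD1 setT) ?inE //= cardsT card_ord hpolyE leqnn.
    by rewrite subnn num_monos0.
  case: (ex_minnP ex) => c Hc cmin; exists c => // d.
  by apply: contraTeq; rewrite -lt0n -leqNgt; exact: cmin.
have [_ ge] := hdepthP HI Hmin Hc (real0 (~: F)).
by rewrite addn1; apply: ge; exact: realizable_hfaces.
Qed.
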